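(* Let $p$ be a probability density on $\mathbb{R}^d$ such that (i) $p$ is log-concave and $p(x)>0$ for all $x$, and (ii) $p$ is three times differentiable with $M:=\sup_x\|\nabla^3\ln p(x)\|_F<\infty$. Let $f:\mathbb{R}^d\to\mathbb{R}$ be convex, bounded below and $L_f$-smooth, let $\lambda>0$, and let $J(x):=\lambda f(x)-\ln p(x)$. Assume $J$ attains its minimum, let $x^\star_{\rm MAP}$ be a minimiser and $J^\star:=J(x^\star_{\rm MAP})$. Let $y\in\mathbb{R}^d$, $0<\tau\le 1/(\lambda L_f)$, $c>0$, $\eta>0$, and $n_k:=\lfloor c\,k^{1+\eta}\rfloor$ for $k\ge1$. Consider the following approximate proximal gradient algorithm: $\hat x_0=y$ and for $k\ge0$: set $z^{(0)}_{k+1}=\hat x_k-\tau\lambda\nabla f(\hat x_k)$; for $i=0,\dots,n_{k+1}-1$ set $\sigma_i=\sqrt{\tau/(i+1)}$, $\alpha_i=(i+1)/(i+2)$ and $z^{(i+1)}_{k+1}=\alpha_i\,\mathrm{MMSE}_{\sigma_i}(z^{(i)}_{k+1})+(1-\alpha_i)z^{(0)}_{k+1}$; then set $\hat x_{k+1}=z^{(n_{k+1})}_{k+1}$. For $k\ge1$ let $x_k:=\mathrm{prox}_{-\tau\ln p}\big(\hat x_{k-1}-\tau\lambda\nabla f(\hat x_{k-1})\big)$ be the exact proximal update. Then there exist constants $C_1,C_2>0$, depending on the problem parameters ($y$, $\tau$, $\lambda$, $f$, $p$, $d$, $c$, $\eta$) but not on $k$, such that for all $k\ge1$ $$\frac1k\sum_{i=1}^k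 J(x_i)-J^\star\le \frac{C_1}{k}\qquad\text{and}\qquad \|\hat x_k-x_k\|\le C_2\,\frac{1+\ln k}{k^{1+\eta}}.$$
   Context: For $\sigma>0$, $p_\sigma$ denotes the density of $X+\sigma\varepsilon$ with $X\sim p$, $\varepsilon\sim\mathcal N(0,I_d)$ independent, and $\mathrm{MMSE}_\sigma(z):=\mathbb{E}[X\mid X+\sigma\varepsilon=z]$. $\mathrm{prox}_{-\tau\ln p}(u):=\arg\min_x\{\tfrac12\|u-x\|^2-\tau\ln p(x)\}$. For a tensor $A\in\mathbb{R}^{d\times d\times d}$, $\|A\|_F=(\sum_{i,j,k}A_{ijk}^2)^{1/2}$. $L_f$-smooth means $\nabla f$ is $L_f$-Lipschitz. The paper writes the bounds as $O(1/k)$ and $\tilde O(1/k^{1+\eta})$ (the latter hiding logarithmic factors). *)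

(* Defs.v *)
From mathcomp Require Import all_boot all_order all_algebra.
From mathcomp Require Import all_classical all_reals all_analysis.
Set Implicit Arguments. Unset Strict Implicit. Unset Printing Implicit Defensive.
Import Order.TTheory GRing.Theory Num.Theory.
Import numFieldNormedType.Exports.
Local Open Scope classical_set_scope.
Local Open Scope ring_scope.

Section Defs.
Variable R : realType.
Variable d : nat.
Notation vec := 'rV[R]_d.

(* Euclidean norm on R^d (the matrix norm of mathcomp is the sup norm). *)
Definition enorm (x : vec) : R := Num.sqrt (\sum_(i < d) x 0 i ^+ 2).

Definition partial (i : 'I_d) (g : vec -> R) (x : vec) : R :=
  derive g x (delta_mx 0 i).

Definition grad (g : vec -> R) (x : vec) : vec := \row_(i < d) partial i g x.

Definition thrice_differentiable (g : vec -> R) : Prop :=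
  [/\ forall x, differentiable g x,
      forall i x, differentiable (partial i g) x &
      forall i j x, differentiable (partial j (partial i g)) x].

Definition third_deriv_frob (g : vec -> R) (x : vec) : R :=
  Num.sqrt (\sum_(i < d) \sum_(j < d) \sum_(k < d)
              (partial i (partial j (partial k g)) x) ^+ 2).

Definition convex_fun (g : vec -> R) : Prop :=
  forall (x y : vec) (t : R), 0 <= t <= 1 ->
    g (t *: x + (1 - t) *: y) <= t * g x + (1 - t) * g y.

Definition log_concave (p : vec -> R) : Prop :=
  forall (x y : vec) (t : R), 0 <= t <= 1 ->
    t * ln (p x) + (1 - t) * ln (p y) <= ln (p (t *: x + (1 - t) *: y)).

Definition L_smooth (L : R) (g : vec -> R) : Prop :=
  (forall x, differentiable g x) /\
  forall x y, enorm (grad g x - grad g y) <= L * enorm (x - y).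

(* Iterated Lebesgue integral over the first n coordinates of a point
   represented as nat -> R (coordinate n-1 outermost). For nonnegative
   measurable integrands this is the Lebesgue integral on R^n (Tonelli). *)
Fixpoint iintE (n : nat) (g : (nat -> R) -> \bar R) : \bar R :=
  match n with
  | 0 => g (fun _ => 0)
  | n'.+1 => (\int[lebesgue_measure]_t
                 iintE n' (fun v => g (fun k => if k == n' then t else v k)))%E
  end.

Definition intRdE (h : vec -> \bar R) : \bar R :=
  iintE d (fun v => h (\row_(i < d) v i)).

Definition intRd (h : vec -> R) : R :=
  fine (intRdE (fun x => (Num.max (h x) 0)%:E)
        - intRdE (fun x => (Num.max (- h x) 0)%:E))%E.

Definition prob_density (p : vec -> R) : Prop :=
  (forall x, 0 <= p x) /\ intRdE (fun x => (p x)%:E) = 1%E.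

Definition gauss (sigma : R) (w : vec) : R :=
  (Num.sqrt (2 * pi * sigma ^+ 2))^-1 ^+ d *
  expR (- (enorm w ^+ 2) / (2 * sigma ^+ 2)).

(* density of X + sigma * eps *)
Definition p_sigma (p : vec -> R) (sigma : R) (z : vec) : R :=
  intRd (fun x => p x * gauss sigma (z - x)).

(* MMSE_sigma(z) = E[X | X + sigma eps = z], posterior mean. *)
Definition MMSE (p : vec -> R) (sigma : R) (z : vec) : vec :=
  \row_(j < d) (intRd (fun x => x 0 j * p x * gauss sigma (z - x))
                / p_sigma p sigma z).

(* prox_{-tau ln p}(u) := argmin_x 1/2 |u - x|^2 - tau ln p(x)
   (chosen minimiser; unique under the theorem's hypotheses). *)
Definition prox_neglog (p : vec -> R) (tau : R) (u : vec) : vec :=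
  xget 0 [set x | forall z : vec,
     enorm (u - x) ^+ 2 / 2 - tau * ln (p x)
       <= enorm (u - z) ^+ 2 / 2 - tau * ln (p z)].

Fixpoint inner_iter (p : vec -> R) (tau : R) (z0 : vec) (i : nat) : vec :=
  match i with
  | 0 => z0
  | i'.+1 =>
      let sigma := Num.sqrt (tau / i'.+1%:R) in
      let alpha := i'.+1%:R / i'.+2%:R in
      alpha *: MMSE p sigma (inner_iter p tau z0 i') + (1 - alpha) *: z0
  end.

Definition n_iter (c eta : R) (k : nat) : nat :=
  Num.truncn (c * powR k%:R (1 + eta)).

Fixpoint xhat (p f : vec -> R) (lambda tau c eta : R) (y : vec) (k : nat)
  : vec :=
  match k with
  | 0 => y
  | k'.+1 =>
      let u := xhat p f lambda tau c eta y k' in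
      inner_iter p tau (u - (tau * lambda) *: grad f u) (n_iter c eta k'.+1)
  end.

Definition xexact (p f : vec -> R) (lambda tau c eta : R) (y : vec) (k : nat)
  : vec :=
  let u := xhat p f lambda tau c eta y k.-1 in
  prox_neglog p tau (u - (tau * lambda) *: grad f u).

Definition Jobj (p f : vec -> R) (lambda : R) (x : vec) : R :=
  lambda * f x - ln (p x).

End Defs.

(* Main.v *)
(**
Write [l := ln p] and let [w_z(x) = p(x) exp(-|z-x|^2/(2s))] with [s = sigma^2]; [MMSE_sigma(z)] is the
mean [m(z)] of the probability density proportional to [w_z].

Denoiser.  By convexity of [exp], [m] is a subgradient of [psi(z) = |z|^2/2 + s ln (int w_z)].  By the
Prékopa-Leindler inequality [|z|^2/2 - psi] is convex, so [psi] is 1-smooth and the Baillon-Haddad argument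
makes [m] nonexpansive.  Integration by parts gives [m(x) - x = s E[grad l]] and, by concavity of [l],
[E|X-x|^2 <= 2sd + s^2 |grad l x|^2]; a Taylor expansion of [grad l] with third derivatives bounded by
[M] then yields [|m(x) - x - s grad l x| <= B s^2], uniformly for [x] in a ball.

Inner loop.  Started at [x - tau grad l x], the recursion satisfies [(i+2) e_(i+1) <= (i+1) e_i + tau^2 B/(i+1)]
for [e_i = |z_i - x|], hence [e_n = O((1 + ln n)/n)].  Moreover the n-th inner iterate is a nonexpansive
function of its starting point.

Outer loop.  The constant [B] is only locally uniform, so the iterates must first be shown to be bounded.
Comparing with the inner iteration that belongs to the fixed minimiser [xstar], whose error rate is known,
gives [|xhat_(k+1) - xstar| <= |xhat_k - xstar| + O((1 + ln k)/k^(1+eta))], which is summable.  The bounds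
then follow from the proximal gradient inequality
[J(x_(k+1)) - J(xstar) <= (|xhat_k - xstar|^2 - |x_(k+1) - xstar|^2)/(2 tau)] by telescoping.
*)

From mathcomp Require Import all_boot all_order all_algebra.
From mathcomp Require Import all_classical all_reals all_analysis.
From mathcomp Require Import measurable_realfun ring lra.
Require Import Defs.
Set Implicit Arguments. Unset Strict Implicit. Unset Printing Implicit Defensive.
Import Order.TTheory GRing.Theory Num.Theory.
Import numFieldNormedType.Exports.
Local Open Scope classical_set_scope.
Local Open Scope ring_scope.

(** * Gaussian-dominated iterated integrals *)

Section GaussianDominated.
Variable R : realType.
Local Notation mu := (@lebesgue_measure R).
Local Notation V := (nat -> R).

(** Dominated convergence concerns sequences, so continuity of parametric integrals is reached
    sequentially; on the first countable real line this suffices. *)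
Lemma seq_continuous (g : R -> R) :
  (forall (u : nat -> R) t, u k @[k --> \oo] --> t -> g (u k) @[k --> \oo] --> g t) ->
  continuous g.
Proof. by move=> H t; apply/(@cvg_nbhsP _ R^o) => u; exact: H. Qed.

Definition gauss1 (a t : R) := expR (- a * t ^+ 2).

Lemma gauss1_le1 a t : 0 <= a -> gauss1 a t <= 1.
Proof. by move=> a0; rewrite /gauss1 -expR0 ler_expR mulNr oppr_le0 mulr_ge0 ?sqr_ge0. Qed.

Lemma integrable_gauss1 a : 0 < a -> mu.-integrable setT (EFin \o gauss1 a).
Proof.
(* With [s ^+ 2 = 1 / (2 a)] the exponent [- t^2 / (2 s^2)] of the normal density is [- a t^2];
   dividing by the peak removes the normalisation. *)
move=> a0; pose s := Num.sqrt (a^-1 / 2).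
have s0 : s != 0 by rewrite gt_eqF// sqrtr_gt0 divr_gt0 ?invr_gt0.
have -> : EFin \o gauss1 a =
    (fun t => ((normal_peak s)^-1%:E * (normal_pdf 0 s t)%:E)%E).
  apply/funext => t /=; rewrite -EFinM normal_pdfE// mulKf ?gt_eqF ?normal_peak_gt0//.
  congr (expR _)%:E; rewrite subr0 sqr_sqrtr ?divr_ge0 ?invr_ge0 ?ltW//.
  rewrite -mulr_natr divfK ?pnatr_eq0// invrK mulrC; ring.
apply: integrableZl => //; exact: integrable_normal_pdf.
Qed.

Lemma integrable_dom (g : R -> R) a C : 0 < a -> continuous g ->
  (forall t, `|g t| <= C * gauss1 a t) -> mu.-integrable setT (EFin \o g).
Proof.
move=> a0 cg gC.
have ig : mu.-integrable setT (fun t => (C%:E * (gauss1 a t)%:E)%E).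
  by apply: integrableZl => //; exact: integrable_gauss1.
apply: le_integrable ig => //.
- by apply/measurable_EFinP; apply: continuous_measurable_fun.
- move=> t _ /=; rewrite lee_fin (le_trans (gC t))//; exact: ler_norm.
Qed.

Lemma dct_dom (g_ : nat -> R -> R) (g : R -> R) a C : 0 < a ->
  (forall k, continuous (g_ k)) -> continuous g ->
  (forall k t, `|g_ k t| <= C * gauss1 a t) ->
  (forall t, g_ k t @[k --> \oo] --> g t) ->
  \int[mu]_t g_ k t @[k --> \oo] --> \int[mu]_t g t.
Proof.
move=> a0 cg_ cg gC gg.
have m1 k : measurable_fun setT (fun t => (g_ k t)%:E).
  by apply/measurable_EFinP; apply: continuous_measurable_fun.
have m2 : measurable_fun setT (EFin \o g).
  by apply/measurable_EFinP; apply: continuous_measurable_fun.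
have cv : {ae mu, forall t, setT t -> (g_ k t)%:E @[k --> \oo] --> (EFin \o g) t}.
  by apply/aeW => t _; apply: cvg_EFin; [exact: nearW|exact: gg].
have ig : mu.-integrable setT (fun t => (C%:E * (gauss1 a t)%:E)%E).
  by apply: integrableZl => //; exact: integrable_gauss1.
have dm : {ae mu, forall t k, setT t -> (`|(g_ k t)%:E| <= C%:E * (gauss1 a t)%:E)%E}.
  by apply/aeW => t k _; rewrite /= lee_fin.
have [i2 _] := @dominated_convergence _ (measurableTypeR R) R mu setT measurableT
  (fun k t => (g_ k t)%:E) (EFin \o g) (fun t => (C%:E * (gauss1 a t)%:E)%E)
  m1 m2 cv ig dm.
rewrite -[X in _ --> X]fineK; last exact: integrable_fin_num.
by move/fine_cvgP => [].
Qed.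

Definition upd (n : nat) (t : R) (v : V) : V := fun k => if k == n then t else v k.
Definition sqn n (v : V) : R := \sum_(i < n) v i ^+ 2.
Definition pcvg (u : nat -> V) (v : V) := forall i, u k i @[k --> \oo] --> v i.
(* Continuous convergence along coordinatewise convergent sequences of points: this is
   the form of continuity that dominated convergence propagates through [riint]. *)
Definition ccvg (h_ : nat -> V -> R) (h : V -> R) :=
  forall u v, pcvg u v -> h_ k (u k) @[k --> \oo] --> h v.
Definition scont (h : V -> R) := ccvg (fun=> h) h.
Definition gdom n a C (h : V -> R) := forall v, `|h v| <= C * expR (- a * sqn n v).

(** Real-valued counterpart of [iintE], with the same order of integration. Both agree on
    Gaussian-dominated integrands, see [iintE_riint]. *)
Fixpoint riint n (h : V -> R) : R :=
  if n is n'.+1 then \int[mu]_t riint n' (fun v => h (upd n' t v)) else h (fun=> 0).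

Lemma sqn_ge0 n v : 0 <= sqn n v.
Proof. by apply: sumr_ge0 => i _; rewrite sqr_ge0. Qed.

Lemma sqn_upd n t v : sqn n.+1 (upd n t v) = sqn n v + t ^+ 2.
Proof.
rewrite /sqn big_ord_recr /= /upd eqxx; congr (_ + _).
by apply: eq_bigr => i _; rewrite ltn_eqF.
Qed.

Lemma gdom_ge0 n a C h : gdom n a C h -> 0 <= C.
Proof.
move=> /(_ (fun=> 0)) /(le_trans (normr_ge0 _)).
by rewrite pmulr_lge0 ?expR_gt0.
Qed.

(** The factor [gauss1 a t] is kept in the constant because it later dominates the integral over the
    outer variable [t]. *)
Lemma gdom_slice n a C h t : gdom n.+1 a C h ->
  gdom n a (C * gauss1 a t) (fun v => h (upd n t v)).
Proof.
move=> H v; apply: le_trans (H _) _.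
by rewrite sqn_upd mulrDr expRD -mulrA (mulrC (expR _)).
Qed.

Lemma gdom_le n a C C' h : C <= C' -> gdom n a C h -> gdom n a C' h.
Proof. by move=> CC H v; apply: le_trans (H v) _; rewrite ler_wpM2r ?expR_ge0. Qed.

(** A constant free of [t] is needed when the slices vary along a sequence of values of [t]. *)
Lemma gdom_slice_unif n a C h t : 0 <= a -> gdom n.+1 a C h ->
  gdom n a C (fun v => h (upd n t v)).
Proof.
move=> a0 H; apply: gdom_le (gdom_slice t H).
by rewrite ler_piMr ?gauss1_le1//; exact: gdom_ge0 H.
Qed.

Lemma pcvg_cst v : pcvg (fun=> v) v. Proof. by move=> i; exact: cvg_cst. Qed.

Lemma pcvg_upd n (s : nat -> R) t u v : s k @[k --> \oo] --> t -> pcvg u v ->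
  pcvg (fun k => upd n (s k) (u k)) (upd n t v).
Proof. by move=> st uv i; rewrite /upd; case: eqP. Qed.

Lemma ccvg_slice n (s : nat -> R) t h_ h : s k @[k --> \oo] --> t -> ccvg h_ h ->
  ccvg (fun k v => h_ k (upd n (s k) v)) (fun v => h (upd n t v)).
Proof. by move=> st hh u v uv; apply: hh; exact: pcvg_upd. Qed.

Lemma scont_slice n t h : scont h -> scont (fun v => h (upd n t v)).
Proof. by move=> sh; apply: (@ccvg_slice n (fun=> t)) sh; exact: cvg_cst. Qed.

Lemma ccvg_pt h_ h v : ccvg h_ h -> h_ k v @[k --> \oo] --> h v.
Proof. by apply; exact: pcvg_cst. Qed.

Definition gmass a := \int[mu]_t gauss1 a t.

(** The two claims are proved by a joint induction: convergence in dimension [n] makes slice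
    integrals continuous in the outer variable, hence measurable, and the bound in dimension [n]
    dominates them by a multiple of [gauss1 a], as dominated convergence in dimension [n.+1]
    requires. *)
Lemma riint_bound_cvg n a : 0 < a ->
  (forall C h, scont h -> gdom n a C h -> `|riint n h| <= C * gmass a ^+ n) /\
  (forall C h_ h, (forall k, scont (h_ k)) -> (forall k, gdom n a C (h_ k)) ->
    scont h -> gdom n a C h -> ccvg h_ h ->
    riint n (h_ k) @[k --> \oo] --> riint n h).
Proof.
move=> a0; elim: n => [|n [IHb IHc]].
  split=> [C h sh /(_ (fun=> 0))|C h_ h sh_ gh_ sh gh hh].
    by rewrite /sqn big_ord0 mulr0 expR0 !mulr1.
  exact: ccvg_pt.
have slc C h : scont h -> gdom n.+1 a C h ->
    continuous (fun t => riint n (fun v => h (upd n t v))).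
  move=> sh gh; apply: seq_continuous => u t ut.
  apply: (IHc C); try exact: scont_slice.
  - by move=> k; exact: scont_slice.
  - by move=> k; exact: gdom_slice_unif (ltW a0) gh.
  - exact: gdom_slice_unif (ltW a0) gh.
  - exact: (@ccvg_slice _ _ _ (fun=> h)).
have slb C h t : scont h -> gdom n.+1 a C h ->
    `|riint n (fun v => h (upd n t v))| <= C * gmass a ^+ n * gauss1 a t.
  move=> sh gh; rewrite mulrAC; apply: IHb; first exact: scont_slice.
  exact: gdom_slice.
split=> [C h sh gh|C h_ h sh_ gh_ sh gh hh] /=.
  have ih : mu.-integrable setT (EFin \o (fun t => riint n (fun v => h (upd n t v)))).
    by apply: (integrable_dom a0 (slc _ _ sh gh)) => t; exact: slb.
  apply: le_trans (le_normr_Rintegral _ ih) _ => //.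
  rewrite exprSr mulrA -RintegralZl//; last exact: integrable_gauss1.
  apply: le_Rintegral => //.
  - exact: (integrable_abse ih).
  - have := integrableZl measurableT (C * gmass a ^+ n) (integrable_gauss1 a0).
    by under eq_fun do rewrite /= -EFinM.
  - by move=> t _; exact: slb.
apply: (dct_dom a0).
- by move=> k; exact: slc.
- exact: slc gh.
- by move=> k t; exact: slb.
- move=> t; apply: (IHc C).
  + by move=> k; exact: scont_slice.
  + by move=> k; exact: gdom_slice_unif (ltW a0) (gh_ k).
  + exact: scont_slice.
  + exact: gdom_slice_unif (ltW a0) gh.
  + by apply: (@ccvg_slice _ (fun=> t)) hh; exact: cvg_cst.
Qed.

Definition seq_gdominated n (h : V -> R) := scont h /\ exists a C, 0 < a /\ gdom n a C h.

Lemma seq_gdominated_slice n h t : seq_gdominated n.+1 h -> seq_gdominated n (fun v => h (upd n t v)).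
Proof.
move=> [sh [a [C [a0 gh]]]]; split; first exact: scont_slice.
by exists a, C; split => //; apply: gdom_slice_unif gh; exact: ltW.
Qed.

Lemma continuous_slice n h : seq_gdominated n.+1 h ->
  continuous (fun t => riint n (fun v => h (upd n t v))).
Proof.
move=> [sh [a [C [a0 gh]]]]; apply: seq_continuous => u t ut.
apply: ((riint_bound_cvg n a0).2 C).
- by move=> k; exact: scont_slice.
- by move=> k; exact: gdom_slice_unif (ltW a0) gh.
- exact: scont_slice.
- exact: gdom_slice_unif (ltW a0) gh.
- exact: (@ccvg_slice _ _ _ (fun=> h)).
Qed.

Lemma slice_dom n h : seq_gdominated n.+1 h -> exists a C, 0 < a /\
  forall t, `|riint n (fun v => h (upd n t v))| <= C * gauss1 a t.
Proof.
move=> [sh [a [C [a0 gh]]]]; exists a, (C * gmass a ^+ n); split => // t.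
rewrite mulrAC; apply: (riint_bound_cvg n a0).1; first exact: scont_slice.
exact: gdom_slice.
Qed.

Lemma integrable_slice n h : seq_gdominated n.+1 h ->
  mu.-integrable setT (EFin \o (fun t => riint n (fun v => h (upd n t v)))).
Proof.
move=> ah; have [a [C [a0 H]]] := slice_dom ah.
exact: integrable_dom a0 (continuous_slice ah) H.
Qed.

(** Every slice integral is integrable, so its extended integral is finite and the passage to real
    numbers by [fine] loses nothing. *)
Lemma iintE_riint n h : seq_gdominated n h -> iintE n (fun v => (h v)%:E) = (riint n h)%:E.
Proof.
elim: n h => [//|n IH] h ah /=.
rewrite fineK; last exact: integrable_fin_num (integrable_slice ah).
by apply: eq_integral => t _; rewrite -IH//; exact: seq_gdominated_slice.
Qed.

Lemma seq_gdominated_minexp n h1 h2 : seq_gdominated n h1 -> seq_gdominated n h2 ->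
  exists a C1 C2, [/\ 0 < a, gdom n a C1 h1 & gdom n a C2 h2].
Proof.
have shrink a b C h : b <= a -> gdom n a C h -> gdom n b C h.
  move=> ba g v; apply: le_trans (g v) _; apply: ler_wpM2l; first exact: gdom_ge0 g.
  by rewrite ler_expR ler_wpM2r ?sqn_ge0// lerN2.
move=> [_ [a1 [C1 [a10 g1]]]] [_ [a2 [C2 [a20 g2]]]].
exists (Num.min a1 a2), C1, C2; split; first by rewrite lt_min a10.
  by apply: shrink g1; rewrite ge_min lexx.
by apply: shrink g2; rewrite ge_min lexx orbT.
Qed.

Lemma seq_gdominatedD n h1 h2 : seq_gdominated n h1 -> seq_gdominated n h2 -> seq_gdominated n (fun v => h1 v + h2 v).
Proof.
move=> a1 a2; have [a [C1 [C2 [a0 g1 g2]]]] := seq_gdominated_minexp a1 a2.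
case: a1 a2 => s1 _ [s2 _]; split.
  by move=> u v uv; apply: cvgD; [exact: s1|exact: s2].
exists a, (C1 + C2); split => // v.
by rewrite mulrDl (le_trans (ler_normD _ _))// lerD.
Qed.

Lemma seq_gdominatedZ n c h : seq_gdominated n h -> seq_gdominated n (fun v => c * h v).
Proof.
move=> [sh [a [C [a0 g]]]]; split.
  by move=> u v uv; apply: cvgM; [exact: cvg_cst|exact: sh].
by exists a, (`|c| * C); split => // v; rewrite normrM -mulrA ler_wpM2l.
Qed.

Lemma riintD n h1 h2 : seq_gdominated n h1 -> seq_gdominated n h2 ->
  riint n (fun v => h1 v + h2 v) = riint n h1 + riint n h2.
Proof.
elim: n h1 h2 => [//|n IH] h1 h2 a1 a2 /=.
rewrite -RintegralD//; try exact: integrable_slice.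
by apply: eq_Rintegral => t _; rewrite IH//; exact: seq_gdominated_slice.
Qed.

Lemma riintZ n c h : seq_gdominated n h -> riint n (fun v => c * h v) = c * riint n h.
Proof.
elim: n h => [//|n IH] h a1 /=.
rewrite -RintegralZl//; last exact: integrable_slice.
by apply: eq_Rintegral => t _; rewrite IH//; exact: seq_gdominated_slice.
Qed.

Lemma le_riint n h1 h2 : seq_gdominated n h1 -> seq_gdominated n h2 -> (forall v, h1 v <= h2 v) ->
  riint n h1 <= riint n h2.
Proof.
elim: n h1 h2 => [|n IH] h1 h2 a1 a2 h12 /=; first exact: h12.
apply: le_Rintegral => //; try exact: integrable_slice.
by move=> t _; apply: IH => //; exact: seq_gdominated_slice.
Qed.

(** A zero integral would make [g] vanish almost everywhere; the exceptional null set would then be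
    the whole line, which contains an interval of measure 1. *)
Lemma Rintegral_gt0 (g : R -> R) : mu.-integrable setT (EFin \o g) ->
  (forall t, 0 < g t) -> 0 < \int[mu]_t g t.
Proof.
move=> ig g0; rewrite lt_neqAle Rintegral_ge0 ?andbT; last by move=> t _; exact: ltW.
apply/eqP => /esym H.
have mg : measurable_fun setT (EFin \o g) by apply: measurable_int ig.
have I0 : (\int[mu]_t `|(EFin \o g) t| = 0)%E.
  have -> : (\int[mu]_t `|(EFin \o g) t| = \int[mu]_t (g t)%:E)%E.
    by apply: eq_integral => t _ /=; rewrite ger0_norm// ltW.
  by rewrite -[LHS]fineK ?integrable_fin_num// -/(Rintegral mu setT g) H.
have [N [mN N0 NP]] := (ae_eq_integral_abs mu measurableT mg).1 I0.
have NT : N = setT.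
  apply/seteqP; split => // t _; apply: NP => /(_ I) /= [] /eqP.
  by rewrite gt_eqF.
move: N0; rewrite NT; apply/eqP.
rewrite gt_eqF//; apply: (@lt_le_trans _ _ (mu `[0%R, 1%R])); last by apply: le_measure; rewrite ?inE.
by rewrite lebesgue_measure_itv /= lte_fin ltr01 oppr0 adde0 lte_fin ltr01.
Qed.

Lemma riint_gt0 n h : seq_gdominated n h -> (forall v, 0 < h v) -> 0 < riint n h.
Proof.
elim: n h => [|n IH] h ah h0 /=; first exact: h0.
apply: Rintegral_gt0; first exact: integrable_slice.
by move=> t; apply: IH => //; exact: seq_gdominated_slice.
Qed.


(** Dominated convergence for restrictions of [g]. The flag [b] treats at once sets that eventually
    contain each point and sets that eventually miss it. *)
Lemma cvg_Rintegral_sets (D : nat -> set R) (b : bool) (g : R -> R) :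
  mu.-integrable setT (EFin \o g) -> (forall k, measurable (D k)) ->
  (forall t, \forall k \near \oo, (t \in D k) = b) ->
  \int[mu]_(t in D k) g t @[k --> \oo] --> (if b then \int[mu]_t g t else 0).
Proof.
move=> ig mD Db.
have mg : measurable_fun setT (EFin \o g) by exact: measurable_int ig.
have m1 k : measurable_fun setT ((EFin \o g) \_ (D k)).
  by apply: (iffLR (measurable_restrictT _ (mD k))); apply: measurable_funTS mg.
have m2 : measurable_fun setT (fun t => if b then (EFin \o g) t else 0%E).
  by case: b {Db}.
have cv : {ae mu, forall t, setT t -> ((EFin \o g) \_ (D k)) t @[k --> \oo] -->
    (if b then (EFin \o g) t else 0%E)}.
  apply/aeW => t _; apply: cvg_near_cst; near=> k.
  by rewrite patchE (near (Db t) k).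
have dm : {ae mu, forall t k, setT t -> (`|((EFin \o g) \_ (D k)) t| <= `|(EFin \o g) t|)%E}.
  by apply/aeW => t k _; rewrite patchE; case: ifP => // _; rewrite abse0.
have [_ _] := @dominated_convergence _ (measurableTypeR R) R mu setT measurableT
  (fun k => (EFin \o g) \_ (D k)) (fun t => if b then (EFin \o g) t else 0%E)
  (abse \o (EFin \o g)) m1 m2 cv (integrable_abse ig) dm.
have -> : (\int[mu]_x (if b then (EFin \o g) x else 0))%E = ((if b then \int[mu]_t g t else 0)%:E).
  case: b {Db m2 cv}; first by rewrite fineK// integrable_fin_num.
  by rewrite integral0.
move/fine_cvgP => [_]; under eq_cvg do rewrite /= -integral_mkcond.
exact.
Unshelve. all: by end_near. Qed.

(** * Primitives from minus infinity and monotonicity from the sign of the derivative *)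

Definition prim (g : R -> R) (x : R) : R := \int[mu]_(t in `]-oo, x]) g t.

Lemma is_derive_prim (g : R -> R) (x : R) : mu.-integrable setT (EFin \o g) -> continuous g ->
  is_derive x 1 (prim g) (g x).
Proof.
move=> ig cg.
have ix : mu.-integrable [set` Interval -oo%O (BRight (x + 1))] (EFin \o g).
  exact: integrableS ig.
have x1 : x < x + 1 by rewrite ltrDl.
have [dF dE] := @continuous_FTC1 R g -oo%O x (x + 1) x1 ix (ltNyr _) (cg x).
by split; [exact: dF|rewrite -derive1E].
Qed.

Lemma cvg_prim_pinfty g : mu.-integrable setT (EFin \o g) ->
  prim g k%:R @[k --> \oo] --> \int[mu]_t g t.
Proof.
move=> ig; apply: (@cvg_Rintegral_sets (fun k => `]-oo, k%:R]%classic) true) => // t.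
near=> k; apply/mem_set; rewrite /= in_itv /=.
near: k; exact: nbhs_infty_ger.
Unshelve. all: by end_near. Qed.

Lemma cvg_prim_ninfty g : mu.-integrable setT (EFin \o g) ->
  prim g (- k%:R) @[k --> \oo] --> 0.
Proof.
move=> ig; apply: (@cvg_Rintegral_sets (fun k => `]-oo, - k%:R]%classic) false) => // t.
near=> k; apply/negbTE; rewrite notin_setE /= in_itv /=; apply/negP; rewrite -ltNge.
rewrite ltrNl; near: k; exact: nbhs_infty_gtr.
Unshelve. all: by end_near. Qed.

Lemma prim_ge0 g x : (forall t, 0 <= g t) -> 0 <= prim g x.
Proof. by move=> g0; apply: Rintegral_ge0. Qed.

Lemma prim_le (g : R -> R) (x : R) : mu.-integrable setT (EFin \o g) -> (forall t, 0 <= g t) ->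
  prim g x <= \int[mu]_t g t.
Proof.
move=> ig g0; rewrite /prim Rintegral_mkcond.
apply: le_Rintegral => //.
  rewrite -restrict_EFin; apply/integrable_restrict => //.
  by rewrite setTI; exact: integrableS ig.
by move=> t _; rewrite patchE; case: ifP.
Qed.

Lemma derive_ge0_ndecr (F f : R -> R) : (forall x : R, is_derive x 1 F (f x)) ->
  (forall x, 0 <= f x) -> {homo F : x y / x <= y}.
Proof.
move=> dF f0 x y xy; apply: (@ger0_derive1_ndecr _ F x y) => //.
- by move=> z _; rewrite derive1E derive_val.
- apply: derivable_within_continuous => z _; exact: ex_derive.
Qed.

Lemma derive_gt0_incr (F f : R -> R) : (forall x : R, is_derive x 1 F (f x)) ->
  (forall x, 0 < f x) -> {homo F : x y / x < y}.
Proof.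
move=> dF f0 x y xy; have cF : {within `[x, y], continuous F}.
  by apply: derivable_within_continuous => z _; exact: ex_derive.
have [z _ E] := MVT xy (fun z _ => dF z) cF.
by rewrite -subr_gt0 E mulr_gt0// subr_gt0.
Qed.


(** * Prékopa-Leindler inequality at the midpoint *)

Lemma prim_incr (g : R -> R) : mu.-integrable setT (EFin \o g) -> continuous g ->
  (forall t, 0 < g t) -> {homo prim g : x y / x < y}.
Proof. by move=> ig cg; apply: derive_gt0_incr => x; exact: is_derive_prim. Qed.

Lemma prim_gt0 (g : R -> R) (x : R) : mu.-integrable setT (EFin \o g) -> continuous g ->
  (forall t, 0 < g t) -> 0 < prim g x.
Proof.
move=> ig cg g0; apply: (@le_lt_trans _ _ (prim g (x - 1))).
  by apply: prim_ge0 => t; exact: ltW.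
by apply: prim_incr => //; rewrite gtrBl.
Qed.

Lemma prim_lt (g : R -> R) (x : R) : mu.-integrable setT (EFin \o g) -> continuous g ->
  (forall t, 0 < g t) -> prim g x < \int[mu]_t g t.
Proof.
move=> ig cg g0; apply: (@lt_le_trans _ _ (prim g (x + 1))).
  by apply: prim_incr => //; rewrite ltrDl.
by apply: prim_le => // t; exact: ltW.
Qed.

Lemma prim_surj (g : R -> R) (z : R) : mu.-integrable setT (EFin \o g) -> continuous g ->
  (forall t, 0 < g t) -> 0 < z < \int[mu]_t g t -> exists x, prim g x = z.
Proof.
move=> ig cg g0 /andP[z0 zI].
have [n [nz zn]] : exists n : nat, prim g (- n%:R) < z /\ z < prim g n%:R.
  near \oo => n; exists n; split; near: n.
  - exact: (cvgr_lt _ (cvg_prim_ninfty ig)).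
  - exact: (cvgr_gt _ (cvg_prim_pinfty ig)).
have nn : - (n%:R : R) <= n%:R by rewrite ge0_cp.
have cp : {within `[- n%:R, n%:R], continuous (prim g)}.
  apply: derivable_within_continuous => x _.
  by have := is_derive_prim x ig cg; case.
have [|x _ <-] := IVT nn cp (v := z); last by exists x.
by rewrite ge_min le_max (ltW nz) (ltW zn) orbT.
Unshelve. all: by end_near. Qed.

(* Monotone transport: [T] pushes [f / int f] to [g / int g]; with [phi x = (x + T x)/2] and
   [c = sqrt (int g / int f)], the function [D x = int_(-oo)^(phi x) k - c int_(-oo)^x f] is
   nondecreasing by AM-GM and its lower limit at [-oo] is nonnegative. *)
Lemma PL1 (f g k : R -> R) :
  mu.-integrable setT (EFin \o f) -> continuous f -> (forall t, 0 < f t) ->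
  mu.-integrable setT (EFin \o g) -> continuous g -> (forall t, 0 < g t) ->
  mu.-integrable setT (EFin \o k) -> continuous k -> (forall t, 0 < k t) ->
  (forall s t, f s * g t <= k ((s + t) / 2) ^+ 2) ->
  (\int[mu]_t f t) * (\int[mu]_t g t) <= (\int[mu]_t k t) ^+ 2.
Proof.
move=> if_ cf f0 ig cg g0 ik ck k0 fgk.
set A := \int[mu]_t f t; set B := \int[mu]_t g t; set K := \int[mu]_t k t.
have A0 : 0 < A by exact: Rintegral_gt0.
have B0 : 0 < B by exact: Rintegral_gt0.
have K0 : 0 < K by exact: Rintegral_gt0.
pose r := B / A; have r0 : 0 < r by rewrite divr_gt0.
have exT x : exists y, prim g y = r * prim f x.
  apply: prim_surj => //; rewrite mulr_gt0 ?prim_gt0//=.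
  by rewrite -/B /r mulrAC ltr_pdivrMr// ltr_pM2l// prim_lt.
(* [prim g] is strictly increasing, so this choice inverts it on its range; the default 0 is
   returned only off the range, and [exT] keeps [T] inside it. *)
pose Gi z := xget 0 [set y | prim g y = z].
have GiK : cancel (prim g) Gi.
  move=> y; have /= E := @xgetPex _ 0 [set y' | prim g y' = prim g y] (ex_intro _ y erefl).
  exact: (inc_inj (le_mono (prim_incr ig cg g0)) E).
pose T x := Gi (r * prim f x).
have GT x : prim g (T x) = r * prim f x.
  by rewrite /T; have [y <-] := exT x; rewrite GiK.
have dT (x : R) : is_derive x 1 T (r * f x / g (T x)).
  have dG : is_derive (prim g (T x)) 1 Gi (g (T x))^-1.
    apply: is_derive_inverse; last by rewrite gt_eqF.
    - by apply: (@nearW _ (nbhs (T x))) => y; exact: GiK.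
    - apply: (@nearW _ (nbhs (T x))) => y; apply/differentiable_continuous/derivable1_diffP.
      by have := is_derive_prim y ig cg; case.
    - exact: is_derive_prim.
  have dF : is_derive x 1 (fun x => r * prim f x) (r * f x).
    by have := is_derive_prim x if_ cf => ?; apply: is_deriveZ.
  rewrite GT in dG.
  have := @is_derive1_comp _ Gi (fun x => r * prim f x) x _ _ dG dF.
  by rewrite mulrC.
pose phi x := (x + T x) / 2.
have dphi (x : R) : is_derive x 1 phi ((1 + r * f x / g (T x)) / 2).
  have := dT x => ?.
  have -> : phi = (fun x => 2^-1 *: (x + T x)).
    by apply/funext => z; rewrite /phi mulrC.
  have H : is_derive x 1 (fun z => z + T z) (1 + r * f x / g (T x)) by apply: is_deriveD.
  by rewrite mulrC; apply: (is_deriveZ (f := fun z => z + T z)).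
pose c := Num.sqrt r; have c0 : 0 <= c by exact: sqrtr_ge0.
pose D x := prim k (phi x) - c * prim f x.
have dD (x : R) : is_derive x 1 D (k (phi x) * ((1 + r * f x / g (T x)) / 2) - c * f x).
  have d1 := @is_derive1_comp _ (prim k) phi x _ _ (is_derive_prim (phi x) ik ck) (dphi x).
  have d2 := is_derive_prim x if_ cf.
  by apply: is_deriveB.
have Dmono : {homo D : x y / x <= y}.
  apply: derive_ge0_ndecr dD _ => x; rewrite subr_ge0.
  set t := r * f x / g (T x).
  have t0 : 0 < t by rewrite divr_gt0// mulr_gt0.
  have tE : t * g (T x) = r * f x by rewrite /t divfK// gt_eqF.
  have P1 : 0 <= c * f x by apply: mulr_ge0 => //; exact: ltW.
  have P2 : 0 <= k (phi x) * ((1 + t) / 2).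
    by apply/ltW/mulr_gt0 => //; apply: divr_gt0 => //; apply: addr_gt0.
  rewrite -(@ler_pXn2r _ 2)// !exprMn sqr_sqrtr; last exact: ltW.
  have h1 : t <= (1 + t) ^+ 2 * 2^-1 ^+ 2 by have := sqr_ge0 (1 - t); nra.
  (* By [tE], [(c f(x))^2 = r f(x)^2] equals [f(x) g(T x) t]; the hypothesis bounds [f(x) g(T x)]
     and [h1] bounds [t]. *)
  apply: (@le_trans _ _ (f x * g (T x) * t)).
    by rewrite -mulrA (mulrC (g _)) tE expr2 mulrCA.
  by apply: ler_pM => //; [apply/ltW/mulr_gt0|exact: ltW].
have D0 x : 0 <= D x.
  have L : - c * prim f (- n%:R) @[n --> \oo] --> - c * 0.
    by apply: cvgM; [exact: cvg_cst|exact: cvg_prim_ninfty].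
  rewrite -(mulr0 (- c)); apply: (cvgr_to_le L).
  near=> n; apply: (@le_trans _ _ (D (- n%:R))).
    by rewrite /D mulNr lerDr prim_ge0// => t; exact: ltW.
  apply: Dmono; rewrite lerNl; near: n; exact: nbhs_infty_ger.
have cA : c * A <= K.
  have L : c * prim f n%:R @[n --> \oo] --> c * A.
    by apply: cvgM; [exact: cvg_cst|exact: cvg_prim_pinfty].
  apply: (cvgr_to_le L); apply: nearW => n.
  have := D0 n%:R; rewrite subr_ge0 => /le_trans; apply.
  by apply: prim_le => // t; exact: ltW.
have -> : A * B = (c * A) ^+ 2.
  by rewrite exprMn sqr_sqrtr; [rewrite /r; field; rewrite gt_eqF|exact: ltW].
by rewrite ler_pXn2r// nnegrE; [apply: mulr_ge0 => //|]; exact: ltW.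
Unshelve. all: by end_near. Qed.

(** Tensorisation: for fixed outer values [s] and [t] the slices satisfy the hypothesis in dimension
    [n], so by induction the slice integrals satisfy the hypothesis of [PL1]. *)
Lemma riint_PL n F G K : seq_gdominated n F -> seq_gdominated n G -> seq_gdominated n K ->
  (forall v, 0 < F v) -> (forall v, 0 < G v) -> (forall v, 0 < K v) ->
  (forall v w, F v * G w <= K (fun i => (v i + w i) / 2) ^+ 2) ->
  riint n F * riint n G <= riint n K ^+ 2.
Proof.
elim: n F G K => [|n IH] F G K aF aG aK F0 G0 K0 H.
  by apply: le_trans (H _ _) _; rewrite (_ : (fun=> _) = fun=> 0)//; apply/funext => i; rewrite addr0 mul0r.
apply: PL1 => //; try exact: integrable_slice; try exact: continuous_slice.
- by move=> t; apply: riint_gt0 => //; exact: seq_gdominated_slice.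
- by move=> t; apply: riint_gt0 => //; exact: seq_gdominated_slice.
- by move=> t; apply: riint_gt0 => //; exact: seq_gdominated_slice.
move=> s t; apply: IH => //; try exact: seq_gdominated_slice.
move=> v w; apply: le_trans (H _ _) _; rewrite (_ : (fun i => _) = upd n ((s + t) / 2) (fun i => (v i + w i) / 2))//.
by apply/funext => i; rewrite /upd; case: eqP.
Qed.

(** * Integration by parts *)

(** For [k >= 1], [exp(a k^2) >= 1 + a k^2 >= a k], so the sequence is squeezed by [1 / (a k)]. *)
Lemma cvg_gauss1 a : 0 < a -> gauss1 a k%:R @[k --> \oo] --> 0.
Proof.
move=> a0; have L : a^-1 * k%:R^-1 @[k --> \oo] --> a^-1 * (0 : R).
  apply: cvgM; first exact: cvg_cst.
  apply: (iffRL (gtr0_cvgV0 _)); last exact: cvgr_idn.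
  by near=> k; rewrite ltr0n; near: k; exact: nbhs_infty_gt.
rewrite mulr0 in L; apply: squeeze_cvgr L; last exact: cvg_cst.
near=> k; rewrite expR_ge0/=.
have k0 : 1 <= (k%:R : R) by rewrite ler1n; near: k; exact: nbhs_infty_gt.
rewrite -invfM /gauss1 mulNr expRN lef_pV2 ?posrE ?expR_gt0//; last first.
  by rewrite mulr_gt0// (lt_le_trans _ k0).
apply: le_trans (expR_ge1Dx _).
have : a * k%:R <= a * k%:R ^+ 2 by rewrite ler_pM2l// expr2 ler_peMl// (le_trans _ k0).
lra.
Unshelve. all: by end_near. Qed.

(** The fundamental theorem on [[-k, k]] leaves only boundary values of [F], which vanish in the
    limit by Gaussian decay. *)
Lemma ibp1 (F f : R -> R) a C : 0 < a -> (forall x : R, is_derive x 1 F (f x)) ->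
  continuous f -> mu.-integrable setT (EFin \o f) ->
  (forall t, `|F t| <= C * gauss1 a t) -> \int[mu]_t f t = 0.
Proof.
move=> a0 dF cf if_ Fb.
have L1 : \int[mu]_(t in `[- k%:R, k%:R]) f t @[k --> \oo] --> \int[mu]_t f t.
  apply: (@cvg_Rintegral_sets (fun k => `[- k%:R, k%:R]%classic) true) => // t.
  near=> k; apply/mem_set; rewrite /= in_itv /= -ler_norml.
  near: k; exact: nbhs_infty_ger.
(* The bound on [F] depends on the square of its argument only, so both endpoints [k] and [- k] are
   covered. *)
have F0 (u : nat -> R) : (forall k, u k ^+ 2 = k%:R ^+ 2) -> F (u k) @[k --> \oo] --> 0.
  move=> uE; apply/norm_cvg0P.
  have L : C * gauss1 a k%:R @[k --> \oo] --> C * 0.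
    by apply: cvgM; [exact: cvg_cst|exact: cvg_gauss1].
  rewrite mulr0 in L; apply: squeeze_cvgr L; last exact: cvg_cst.
  by apply: nearW => k; rewrite normr_ge0 /= (le_trans (Fb _))// /gauss1 uE.
have L2 : F k%:R - F (- k%:R) @[k --> \oo] --> 0 - 0.
  by apply: cvgB; apply: F0 => // k; rewrite sqrrN.
have E : \forall k \near \oo, \int[mu]_(t in `[- k%:R, k%:R]) f t = F k%:R - F (- k%:R).
  near=> k; rewrite /Rintegral (@continuous_FTC2 _ _ F)//.
  - rewrite -subr_gt0 opprK -mulr2n pmulrn_lgt0// ltr0n; near: k; exact: nbhs_infty_gt.
  - by apply: continuous_subspaceT.
  - split; first by move=> t _; have [] := dF t.
    + by apply: cvg_at_right_filter; apply/differentiable_continuous/derivable1_diffP; have [] := dF (- k%:R).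
    + by apply: cvg_at_left_filter; apply/differentiable_continuous/derivable1_diffP; have [] := dF k%:R.
  - by move=> t _; rewrite derive1E derive_val.
rewrite subr0 in L2; apply: cvg_unique L1 _ => //.
by apply: cvg_trans L2; apply: near_eq_cvg; apply: filterS E => k ->.
Unshelve. all: by end_near. Qed.


(** Mean value theorem without an order between [s] and [t]; the intermediate point is located by
    its distance to [t], which is what limits [s --> t] use. *)
Lemma mvt_sym (F f : R -> R) (s t : R) : (forall x : R, is_derive x 1 F (f x)) ->
  exists2 x, `|x - t| <= `|s - t| & F s - F t = f x * (s - t).
Proof.
move=> dF.
have cF a b : {within `[a, b], continuous F}.
  by apply: derivable_within_continuous => z _; exact: ex_derive.
have M a b : a <= b -> exists2 x, a <= x <= b & F b - F a = f x * (b - a).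
  move=> ab; have [x] := MVT_segment ab (fun z _ => dF z) (cF a b).
  by rewrite in_itv /=; exists x.
have [ts|/ltW st] := leP t s.
  have [x /andP[tx xs] E] := M _ _ ts; exists x => //.
  by rewrite !ger0_norm ?subr_ge0// lerD2r.
have [x /andP[sx xt] E] := M _ _ st; exists x.
  by rewrite !ler0_norm ?subr_le0// lerN2 lerD2r.
by rewrite -opprB E -mulrN opprB.
Qed.

(** Differentiation under the integral by Carathéodory's criterion. The difference quotient [q],
    completed by [h'] at [s = t], is a value of [h'] at an intermediate point, so it inherits the
    Gaussian bound of [h'] uniformly in [s]. *)
Lemma is_derive_slice n h h' (t : R) :
  (forall v (t : R), is_derive t 1 (fun s => h (upd n s v)) (h' (upd n t v))) ->
  seq_gdominated n.+1 h -> seq_gdominated n.+1 h' ->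
  is_derive t 1 (fun t => riint n (fun v => h (upd n t v))) (riint n (fun v => h' (upd n t v))).
Proof.
move=> dh ah ah'.
pose q s v := if s == t then h' (upd n t v) else (s - t)^-1 * (h (upd n s v) + -1 * h (upd n t v)).
have qE s v : exists2 x, `|x - t| <= `|s - t| & q s v = h' (upd n x v).
  rewrite /q; case: eqP => [->|/eqP st]; first by exists t.
  have [x xt E] := mvt_sym s t (dh v); exists x => //.
  by rewrite mulN1r E mulrCA mulVf ?mulr1// subr_eq0.
case: (ah') => sh' [a [C [a0 gh']]].
have gq s : gdom n a C (q s).
  by move=> v; have [x _ ->] := qE s v; exact: (gdom_slice_unif x (ltW a0) gh').
have sq s : scont (q s).
  rewrite /q; case: eqP => _; first exact: scont_slice.
  have [+ _] : seq_gdominated n (fun v => (s - t)^-1 * (h (upd n s v) + -1 * h (upd n t v))).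
    by apply/seq_gdominatedZ/seq_gdominatedD; [|apply: seq_gdominatedZ]; exact: seq_gdominated_slice.
  exact.
have cq (u : nat -> R) : u k @[k --> \oo] --> t -> ccvg (fun k => q (u k)) (q t).
  (* The intermediate points need not depend regularly on [k]: being at least as close to [t] as
     [u k], they converge to [t]. *)
  move=> ut v w vw; have /choice[x xP] : forall k, exists x, `|x - t| <= `|u k - t| /\ q (u k) (v k) = h' (upd n x (v k)).
    by move=> k; have [x x1 x2] := qE (u k) (v k); exists x.
  have xt : x k @[k --> \oo] --> t.
    apply/cvgrPdist_lt => e e0; move/cvgrPdist_lt: ut => /(_ _ e0).
    apply: filterS => k; rewrite distrC => uk.
    by rewrite distrC (le_lt_trans (xP k).1).
  rewrite [in X in _ --> X]/q eqxx.
  under eq_cvg do rewrite (xP _).2.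
  by apply: sh'; exact: pcvg_upd.
apply/is_derive1_caratheodory; exists (fun s => riint n (q s)); split.
- move=> s; rewrite {1}/q; have [->|st] := eqVneq s t; first by rewrite !subrr mulr0.
  rewrite riintZ ?riintD ?riintZ//; try exact: seq_gdominated_slice.
  + by rewrite mulN1r mulrAC mulVf ?mul1r// subr_eq0.
  + by apply: seq_gdominatedZ; exact: seq_gdominated_slice.
  + by apply: seq_gdominatedD; [|apply: seq_gdominatedZ]; exact: seq_gdominated_slice.
- apply/(@cvg_nbhsP _ R^o) => u ut.
  by apply: ((riint_bound_cvg n a0).2 C) => //; exact: cq.
- by congr riint; apply/funext => v; rewrite /q eqxx.
Qed.

(** If [j] is the outermost coordinate, [ibp1] applies to the slice integrals. Otherwise the inner
    integral vanishes for every outer value by induction, since updates of distinct coordinates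
    commute. *)
Lemma riint_ibp n j h h' : (j < n)%N ->
  (forall v (t : R), is_derive t 1 (fun s => h (upd j s v)) (h' (upd j t v))) ->
  seq_gdominated n h -> seq_gdominated n h' -> riint n h' = 0.
Proof.
elim: n h h' => [//|n IH] h h' jn dh ah ah' /=.
have [jE|jn'] := eqVneq j n.
  subst j; have [a [C [a0 hb]]] := slice_dom ah.
  apply: (@ibp1 (fun t => riint n (fun v => h (upd n t v))) _ a C) => //.
  - by move=> x; exact: is_derive_slice.
  - exact: continuous_slice.
  - exact: integrable_slice.
rewrite (@eq_Rintegral _ _ _ _ _ (fun=> 0)); first by rewrite /Rintegral integral0.
move=> t _; apply: (IH (fun v => h (upd n t v))); try exact: seq_gdominated_slice.
- by rewrite ltn_neqAle jn' -ltnS.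
- move=> v s; have C z : upd n t (upd j z v) = upd j z (upd n t v).
    apply/funext => i; rewrite /upd; case: (eqVneq i n) => // ->.
    by rewrite eq_sym (negbTE jn').
  by rewrite C; under eq_fun do rewrite C; exact: dh.
Qed.

End GaussianDominated.

(** * Euclidean inner product and norm *)

Section Euclidean.
Variable R : realType.
Variable d : nat.
Local Notation vec := 'rV[R]_d.
Implicit Types (u v w x y z : vec).

Definition dotp u v : R := \sum_(i < d) u 0 i * v 0 i.

Lemma dotpC u v : dotp u v = dotp v u.
Proof. by apply: eq_bigr => i _; rewrite mulrC. Qed.

Lemma dotpDl u v w : dotp (u + v) w = dotp u w + dotp v w.
Proof. by rewrite -big_split; apply: eq_bigr => i _ /=; rewrite mxE mulrDl. Qed.

Lemma dotpDr u v w : dotp w (u + v) = dotp w u + dotp w v.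
Proof. by rewrite dotpC dotpDl !(dotpC w). Qed.

Lemma dotpZl a u w : dotp (a *: u) w = a * dotp u w.
Proof. by rewrite mulr_sumr; apply: eq_bigr => i _ /=; rewrite mxE mulrA. Qed.

Lemma dotpZr a u w : dotp w (a *: u) = a * dotp w u.
Proof. by rewrite dotpC dotpZl dotpC. Qed.

Lemma dotpNl u w : dotp (- u) w = - dotp u w.
Proof. by rewrite -scaleN1r dotpZl mulN1r. Qed.

Lemma dotpNr u w : dotp w (- u) = - dotp w u.
Proof. by rewrite dotpC dotpNl dotpC. Qed.

Definition dotpE := (dotpDl, dotpDr, dotpZl, dotpZr, dotpNl, dotpNr).

Lemma dotp0l w : dotp 0 w = 0.
Proof. by rewrite /dotp big1// => i _; rewrite mxE mul0r. Qed.

Lemma dotpp_ge0 u : 0 <= dotp u u.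
Proof. by apply: sumr_ge0 => i _; rewrite -expr2 sqr_ge0. Qed.

Lemma dotpp_eq0 u : dotp u u <= 0 -> u = 0.
Proof.
move=> u0; have /eqP : dotp u u = 0 by apply/eqP; rewrite eq_le u0 dotpp_ge0.
rewrite psumr_eq0; last by move=> i _; rewrite -expr2 sqr_ge0.
move=> /allP H; apply/rowP => i; rewrite mxE; apply/eqP.
by have := H i (mem_index_enum _); rewrite -expr2 sqrf_eq0.
Qed.

Lemma dotp_delta w i : dotp w (delta_mx 0 i) = w 0 i.
Proof.
rewrite /dotp (bigD1 i)//= big1 ?addr0 ?mxE ?eqxx ?mulr1// => j ji.
by rewrite mxE (negbTE ji) andbF mulr0.
Qed.

Lemma sum_cst (c : R) : \sum_(i < d) c = d%:R * c.
Proof. by rewrite sumr_const card_ord mulr_natl. Qed.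

Lemma enorm_ge0 u : 0 <= enorm u. Proof. exact: sqrtr_ge0. Qed.

Lemma enorm_sqr u : enorm u ^+ 2 = dotp u u.
Proof.
rewrite /enorm sqr_sqrtr; last by apply: sumr_ge0 => i _; rewrite sqr_ge0.
by apply: eq_bigr => i _; rewrite expr2.
Qed.

Lemma enorm_le u (a : R) : 0 <= a -> dotp u u <= a ^+ 2 -> enorm u <= a.
Proof. by move=> a0; rewrite -enorm_sqr ler_pXn2r// nnegrE enorm_ge0. Qed.

(** Cauchy-Schwarz, from expanding the squared norm of [<u,v> u - |u|^2 v] and dividing by
    [|u|^2]. *)
Lemma dotp_le u v : dotp u v <= enorm u * enorm v.
Proof.
have [->|u0] := eqVneq u 0; first by rewrite dotp0l mulr_ge0 ?enorm_ge0.
have u1 : 0 < dotp u u.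
  by rewrite ltNge; apply: contra u0 => /dotpp_eq0 ->.
have H := dotpp_ge0 (dotp u v *: u - dotp u u *: v).
rewrite !dotpE (dotpC v u) in H.
have H1 : dotp u v ^+ 2 <= dotp u u * dotp v v.
  rewrite -(ler_pM2l u1); move: H; nra.
apply: le_trans (ler_norm _) _.
rewrite -(@ler_pXn2r _ 2)// ?nnegrE ?mulr_ge0 ?enorm_ge0//.
by rewrite real_normK ?num_real// exprMn !enorm_sqr.
Qed.

Lemma enormN u : enorm (- u) = enorm u.
Proof. by congr Num.sqrt; apply: eq_bigr => i _; rewrite mxE sqrrN. Qed.

Lemma enormB u v : enorm (u - v) = enorm (v - u).
Proof. by rewrite -enormN opprB. Qed.

Lemma normr_dotp_le u v : `|dotp u v| <= enorm u * enorm v.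
Proof. by rewrite ler_norml dotp_le andbT lerNl -dotpNl -(enormN u) dotp_le. Qed.

Lemma enorm_triangle u v : enorm (u + v) <= enorm u + enorm v.
Proof.
apply: enorm_le; first by rewrite addr_ge0 ?enorm_ge0.
rewrite sqrrD !enorm_sqr !dotpE (dotpC v u).
have := dotp_le u v; lra.
Qed.

Lemma enormZ (a : R) u : enorm (a *: u) = `|a| * enorm u.
Proof.
apply/eqP; rewrite -(@eqrXn2 _ 2)// ?mulr_ge0 ?enorm_ge0//.
by rewrite exprMn !enorm_sqr !dotpE real_normK ?num_real// mulrA expr2.
Qed.

Lemma enorm0 : enorm (0 : vec) = 0.
Proof. by rewrite -(scale0r 0) enormZ normr0 mul0r. Qed.

Lemma enorm_dist_triangle x y z : enorm (x - z) <= enorm (x - y) + enorm (y - z).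
Proof. by rewrite -[x - z](subrKA y) enorm_triangle. Qed.

Lemma normr_coord_le u i : `|u 0 i| <= enorm u.
Proof.
rewrite -(@ler_pXn2r _ 2)// ?nnegrE ?enorm_ge0// enorm_sqr real_normK ?num_real//.
rewrite /dotp (bigD1 i)//= -expr2 lerDl sumr_ge0// => j _; rewrite -expr2 sqr_ge0//.
Qed.

Lemma enorm_le_sum u : enorm u <= \sum_(i < d) `|u 0 i|.
Proof.
rewrite {1}[u]matrix_sum_delta big_ord1.
elim/big_rec2 : _ => [|i a w _ IH]; first by rewrite enorm0.
apply: le_trans (enorm_triangle _ _) _; apply: lerD => //.
rewrite enormZ ler_piMr// /enorm (bigD1 i)//= big1 ?addr0.
  by rewrite mxE !eqxx expr1n sqrtr1.
by move=> j ji; rewrite mxE (negbTE ji) andbF expr0n.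
Qed.

(** Converts Euclidean bounds into bounds for the sup norm, in which bounded sets of row vectors are
    defined. *)
Lemma enorm_dist_norm x y : `|x - y| <= enorm (x - y).
Proof.
rewrite [leLHS]/Num.Def.normr /= mx_normrE.
elim/big_ind : _; first exact: enorm_ge0.
- by move=> a b ha hb; rewrite ge_max ha.
- by move=> -[i j] _; rewrite ord1; exact: normr_coord_le.
Qed.

Lemma cvg_rV (u : nat -> vec) v :
  (forall i, u k 0 i @[k --> \oo] --> v 0 i) -> u k @[k --> \oo] --> v.
Proof.
move=> H; apply/cvg_ballP => e e0.
have : \forall k \near \oo, forall i, ball (v 0 i) e (u k 0 i).
  by apply: filter_forall => i; move/cvg_ballP: (H i); exact.
by apply: filterS => k Hk; split=> // i j; rewrite ord1; exact: Hk.
Qed.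

Lemma continuous_sumr (T : topologicalType) (I : Type) (r : seq I) (f : I -> T -> R) :
  (forall i, continuous (f i)) -> continuous (fun x : T => \sum_(i <- r) f i x).
Proof.
move=> cf; elim: r => [|i r IH].
  by under eq_fun do rewrite big_nil; exact: cst_continuous.
by under eq_fun do rewrite big_cons; move=> x; exact: continuousD (cf i x) (IH x).
Qed.

Lemma continuous_dotp (f g : vec -> vec) : continuous f -> continuous g ->
  continuous (fun x => dotp (f x) (g x)).
Proof.
move=> cf cg; apply: continuous_sumr => i x; apply: continuousM.
  exact: continuous_comp (cf x) (@coord_continuous _ _ _ 0 i (f x)).
exact: continuous_comp (cg x) (@coord_continuous _ _ _ 0 i (g x)).
Qed.

(** * Directional derivatives *)

Lemma is_derive_line (g : vec -> R) x w (t l : R) :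
  is_derive (x + t *: w) w g l -> is_derive t 1 (fun s => g (x + s *: w)) l.
Proof.
have E : (fun h : R => h^-1 *: (((fun s => g (x + s *: w)) \o shift t) (h *: (1:R)) - g (x + t *: w)))
  = (fun h : R => h^-1 *: ((g \o shift (x + t *: w)) (h *: w) - g (x + t *: w))).
  apply/funext => h /=; congr (_ *: (g _ - _)).
  by rewrite [h *: 1]mulr1 scalerDl addrCA.
by move=> [dg gl]; split; rewrite /derivable /derive E.
Qed.

Lemma is_derive_dir (g : vec -> R) x w : differentiable g x ->
  is_derive x w g (dotp (grad g x) w).
Proof.
move=> dg; have -> : dotp (grad g x) w = 'D_w g x.
  rewrite deriveE// {2}[w]matrix_sum_delta big_ord1 linear_sum.
  apply: eq_bigr => i _; rewrite linearZ mxE /partial deriveE//.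
  by rewrite mulrC.
by apply: derivableP; exact: diff_derivable.
Qed.

Lemma is_derive_grad_line (g : vec -> R) x w (t : R) : differentiable g (x + t *: w) ->
  is_derive t 1 (fun s => g (x + s *: w)) (dotp (grad g (x + t *: w)) w).
Proof. by move=> dg; exact/is_derive_line/is_derive_dir. Qed.

(** The right-hand difference quotient is at most [K + t B], and [t B] vanishes with [t]. The slack
    [B] lets one statement serve convexity and the first-order condition of the proximal map. *)
Lemma dir_deriv_le (g : vec -> R) x w (K B : R) : differentiable g x ->
  (forall t, 0 < t <= 1 -> g (x + t *: w) <= g x + t * K + t ^+ 2 * B) ->
  dotp (grad g x) w <= K.
Proof.
move=> dg H; have [] := is_derive_dir w dg.
rewrite /derivable /derive => cD lD.
have L : h^-1 *: (g (h *: w + x) - g x) @[h --> 0^'] --> dotp (grad g x) w.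
  by rewrite -lD; exact: cD.
have {}L : h^-1 *: (g (h *: w + x) - g x) - h * B @[h --> 0^'+] --> dotp (grad g x) w - 0 * B.
  apply: cvgB; first exact: cvg_dnbhs_at_right.
  by apply: cvgM; [exact/cvg_at_right_filter/cvg_id|exact: cvg_cst].
rewrite mul0r subr0 in L; apply: (cvgr_to_le L).
near=> h; have h0 : 0 < h by near: h; exact: nbhs_right_gt.
have h1 : h <= 1 by near: h; exact: nbhs_right_le.
have := H h; rewrite h0 h1 => /(_ isT).
have -> : h^-1 *: (g (h *: w + x) - g x) = h^-1 * (g (x + h *: w) - g x).
  by rewrite [h *: w + x]addrC.
move=> Hh; rewrite lerBlDr mulrC ler_pdivrMr// lerBlDl (le_trans Hh)// le_eqVlt.
by apply/orP; left; apply/eqP; ring.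
Unshelve. all: by end_near. Qed.

Lemma grad_opp (g : vec -> R) x : differentiable g x ->
  grad (fun z => - g z) x = - grad g x.
Proof.
move=> dg; apply/rowP => i; rewrite !mxE /partial deriveN//.
exact: diff_derivable.
Qed.

Lemma convex_grad_le (g : vec -> R) x y : convex_fun g -> differentiable g x ->
  g x + dotp (grad g x) (y - x) <= g y.
Proof.
move=> cg dg; rewrite -lerBrDl; apply: (@dir_deriv_le _ _ _ _ 0) => // t /andP[t0 t1].
have := cg y x t; rewrite (ltW t0) t1 => /(_ isT).
have -> : t *: y + (1 - t) *: x = x + t *: (y - x).
  by rewrite scalerBl scalerBr scale1r addrCA.
lra.
Qed.

Lemma concave_grad_le (g : vec -> R) x y : convex_fun (fun z => - g z) -> differentiable g x ->
  g y <= g x + dotp (grad g x) (y - x).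
Proof.
move=> cg dg; have := @convex_grad_le _ x y cg (differentiableN dg).
by rewrite grad_opp// dotpNl -opprD lerN2.
Qed.

(** Converse of [is_derive_line] at time 0; it reduces directional chain rules to calculus in one
    variable. *)
Lemma is_derive_of_line (g : vec -> R) x w (l : R) :
  is_derive (0 : R) 1 (fun s => g (x + s *: w)) l -> is_derive x w g l.
Proof.
have E : (fun h : R => h^-1 *: (((fun s => g (x + s *: w)) \o shift 0) (h *: (1:R)) - g (x + 0 *: w)))
  = (fun h : R => h^-1 *: ((g \o shift x) (h *: w) - g x)).
  apply/funext => h /=; congr (_ *: (g _ - g _)); last by rewrite scale0r addr0.
  by rewrite [h *: 1]mulr1 addr0 addrC.
by move=> [dg gl]; split; rewrite /derivable /derive -E.
Qed.

Lemma is_derive_line0 (g : vec -> R) x w (l : R) :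
  is_derive x w g l -> is_derive (0 : R) 1 (fun s => g (x + s *: w)) l.
Proof. by move=> dg; apply: is_derive_line; rewrite scale0r addr0. Qed.

Lemma is_derive_dir_comp (phi : R -> R) (g : vec -> R) x w (a l : R) :
  is_derive (g x) 1 phi a -> is_derive x w g l -> is_derive x w (phi \o g) (a * l).
Proof.
move=> dphi dg; apply: is_derive_of_line.
apply: (@is_derive1_comp _ phi (fun s => g (x + s *: w))).
  by rewrite scale0r addr0.
exact: is_derive_line0.
Qed.

Lemma is_derive_sqdist z x w : is_derive x w (fun x => dotp (z - x) (z - x)) (- 2 * dotp (z - x) w).
Proof.
apply: is_derive_of_line.
have -> : (fun s : R => dotp (z - (x + s *: w)) (z - (x + s *: w))) =
  (fun s : R => dotp (z - x) (z - x) + ((- 2 * dotp (z - x) w) * s + dotp w w * s ^+ 2)).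
  apply/funext => s; rewrite !dotpE !(dotpC w) !(dotpC x z); ring.
apply: is_derive_eq.
by rewrite !scale0r !addr0 scaler0 addr0 add0r mul1r [_%:A]mulr1.
Qed.

End Euclidean.

(** * Integration of Gaussian-dominated functions on the space of row vectors *)

Section GaussianIntegral.
Variable R : realType.
Variable d : nat.
Local Notation vec := 'rV[R]_d.
Implicit Types (u v w x y z : vec) (h : vec -> R).

Definition rowv (v : nat -> R) : 'rV[R]_d := \row_(i < d) v i.
Definition intV (h : vec -> R) : R := riint d (fun v : nat -> R => h (rowv v)).
Definition gdominated h := continuous h /\ exists a C : R, 0 < a /\
  forall x, `|h x| <= C * expR (- a * dotp x x).
(** Growth below every Gaussian rate: the class is stable under sums and products, and multiplying a
    Gaussian-dominated function by such a factor costs only part of its exponent. *)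
Definition subgauss h := continuous h /\ forall e : R, 0 < e -> exists C : R,
  forall x, `|h x| <= C * expR (e * dotp x x).

Lemma dotp_rowv (v : nat -> R) : dotp (rowv v) (rowv v) = sqn d v.
Proof. by apply: eq_bigr => i _; rewrite mxE -expr2. Qed.

Lemma gdominated_seq h : gdominated h -> seq_gdominated d (fun v : nat -> R => h (rowv v)).
Proof.
move=> [ch [a [C [a0 H]]]]; split; last by exists a, C; split => // v; rewrite -dotp_rowv.
move=> u v uv; apply: (cvg_comp (fun k => rowv (u k)) h); last exact: ch.
apply: cvg_rV => i; rewrite mxE; under eq_cvg do rewrite mxE; exact: uv.
Qed.

Lemma intV_ext h1 h2 : h1 =1 h2 -> intV h1 = intV h2.
Proof. by move=> /funext ->. Qed.

Lemma gdominated_mul h1 h2 : subgauss h1 -> gdominated h2 -> gdominated (fun x => h1 x * h2 x).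
Proof.
move=> [c1 H1] [c2 [a [C [a0 H2]]]]; split.
  by move=> x; exact: continuousM (c1 x) (c2 x).
have [C1 {}H1] := H1 (a / 2) (divr_gt0 a0 (ltr0Sn R 1)).
exists (a / 2), (C1 * C); split; first by rewrite divr_gt0.
move=> x; rewrite normrM; apply: le_trans (ler_pM _ _ (H1 x) (H2 x)) _ => //.
rewrite mulrACA -expRD le_eqVlt; apply/orP; left; apply/eqP; congr (_ * expR _).
by field.
Qed.

Lemma subgauss_quadratic h (A : R) : continuous h -> (forall x, `|h x| <= A * (1 + dotp x x)) -> subgauss h.
Proof.
move=> ch H; split => // e e0; exists (A * (1 + e^-1)) => x.
have A0 : 0 <= A.
  by have := H 0; rewrite dotp0l addr0 mulr1; apply: le_trans.
apply: le_trans (H x) _; rewrite -mulrA; apply: ler_wpM2l => //.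
have q0 := dotpp_ge0 x; have E := expR_ge1Dx (e * dotp x x).
have i0 : 0 < e^-1 by rewrite invr_gt0.
have : e^-1 * (1 + e * dotp x x) <= e^-1 * expR (e * dotp x x) by rewrite ler_pM2l.
rewrite mulrDr mulrA mulVf ?gt_eqF// mul1r mulr1 => E2.
have : 0 <= e * dotp x x by rewrite mulr_ge0// ltW.
by rewrite mulrDl mul1r; lra.
Qed.

Lemma subgaussM h1 h2 : subgauss h1 -> subgauss h2 -> subgauss (fun x => h1 x * h2 x).
Proof.
move=> [c1 H1] [c2 H2]; split.
  by move=> x; exact: continuousM (c1 x) (c2 x).
move=> e e0; have [C1 {}H1] := H1 (e / 2) (divr_gt0 e0 (ltr0Sn R 1)).
have [C2 {}H2] := H2 (e / 2) (divr_gt0 e0 (ltr0Sn R 1)).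
exists (C1 * C2) => x; rewrite normrM; apply: le_trans (ler_pM _ _ (H1 x) (H2 x)) _ => //.
by rewrite mulrACA -expRD -mulrDl -splitr.
Qed.

Lemma subgaussD h1 h2 : subgauss h1 -> subgauss h2 -> subgauss (fun x => h1 x + h2 x).
Proof.
move=> [c1 H1] [c2 H2]; split.
  by move=> x; exact: continuousD (c1 x) (c2 x).
move=> e e0; have [C1 {}H1] := H1 e e0; have [C2 {}H2] := H2 e e0.
exists (C1 + C2) => x; apply: le_trans (ler_normD _ _) _; rewrite mulrDl.
exact: lerD.
Qed.

Lemma subgauss_cst (c : R) : subgauss (fun=> c).
Proof.
apply: (@subgauss_quadratic _ `|c|); first exact: cst_continuous.
by move=> x; rewrite ler_peMr// lerDl dotpp_ge0.
Qed.

Lemma subgauss_coord i : subgauss (fun x => x 0 i).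
Proof.
apply: (@subgauss_quadratic _ 1); first exact: coord_continuous.
move=> x; rewrite mul1r; apply: le_trans (normr_coord_le _ _) _.
by rewrite -enorm_sqr; have := sqr_ge0 (enorm x - 1); have := sqr_ge0 (enorm x); nra.
Qed.

Lemma subgauss_sum (I : Type) (r : seq I) (F : I -> vec -> R) :
  (forall i, subgauss (F i)) -> subgauss (fun x => \sum_(i <- r) F i x).
Proof.
move=> H; elim: r => [|i r IH].
  by under eq_fun do rewrite big_nil; exact: subgauss_cst.
by under eq_fun do rewrite big_cons; exact: subgaussD.
Qed.

Lemma intVD h1 h2 : gdominated h1 -> gdominated h2 -> intV (fun x => h1 x + h2 x) = intV h1 + intV h2.
Proof. by move=> a1 a2; apply: riintD; exact: gdominated_seq. Qed.

Lemma intVZ c h : gdominated h -> intV (fun x => c * h x) = c * intV h.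
Proof. by move=> a; apply: riintZ; exact: gdominated_seq. Qed.

Lemma le_intV h1 h2 : gdominated h1 -> gdominated h2 -> (forall x, h1 x <= h2 x) -> intV h1 <= intV h2.
Proof. by move=> a1 a2 H; apply: le_riint => //; exact: gdominated_seq. Qed.

Lemma intV_gt0 h : gdominated h -> (forall x, 0 < h x) -> 0 < intV h.
Proof. by move=> a H; apply: riint_gt0 => //; exact: gdominated_seq. Qed.

Lemma intV_PL F G K : gdominated F -> gdominated G -> gdominated K ->
  (forall x, 0 < F x) -> (forall x, 0 < G x) -> (forall x, 0 < K x) ->
  (forall x y, F x * G y <= K (2^-1 *: (x + y)) ^+ 2) -> intV F * intV G <= intV K ^+ 2.
Proof.
move=> aF aG aK F0 G0 K0 H; apply: riint_PL => //; try exact: gdominated_seq.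
move=> v w; apply: le_trans (H _ _) _; rewrite [X in _ <= K X ^+ 2](_ : _ = 2^-1 *: (rowv v + rowv w))//.
by apply/rowP => i; rewrite !mxE mulrC.
Qed.

Lemma intV_ibp (j : 'I_d) h h' : (forall x, is_derive x (delta_mx 0 j) h (h' x)) ->
  gdominated h -> gdominated h' -> intV h' = 0.
Proof.
move=> dh ah ah'; apply: (@riint_ibp _ d j (fun v : nat -> R => h (rowv v))); try exact: gdominated_seq.
  exact: ltn_ord.
(* Starting from coordinate [j] equal to 0, updating that coordinate is motion along a line through
   [x0]. *)
move=> v t; pose x0 := rowv (upd j 0 v).
have xE s : rowv (upd j s v) = x0 + s *: delta_mx 0 j.
  apply/rowP => i; rewrite !mxE eqxx /= /upd -!val_eqE /=; case: eqP => _ /=.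
    by rewrite mulr1 add0r.
  by rewrite mulr0 addr0.
under eq_fun do rewrite xE.
by rewrite xE; exact: is_derive_line.
Qed.

Lemma gdominated_pos h : gdominated h -> gdominated (fun x => Num.max (h x) 0).
Proof.
move=> [ch [a [C [a0 H]]]]; split.
  by move=> x; apply: continuous_max; [exact: ch|exact: cst_continuous].
exists a, C; split => // x; apply: le_trans (H x).
by rewrite maxEle; case: ifP; rewrite ?normr0.
Qed.

Lemma gdominated_opp h : gdominated h -> gdominated (fun x => - h x).
Proof.
move=> [ch [a [C [a0 H]]]]; split; first by move=> x; exact: continuousN (ch x).
by exists a, C; split => // x; rewrite normrN.
Qed.

(** The positive and negative parts in [intRd] are both Gaussian-dominated, so their integrals are
    finite and recombine by linearity. *)
Lemma intRd_intV h : gdominated h -> intRd h = intV h.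
Proof.
move=> ah; rewrite /intRd /intRdE.
have ap := gdominated_pos ah; have an := gdominated_pos (gdominated_opp ah).
rewrite (iintE_riint (gdominated_seq ap)) (iintE_riint (gdominated_seq an)) /=.
rewrite -mulN1r -riintZ; last exact: gdominated_seq an.
rewrite -riintD; [|exact: gdominated_seq ap|apply: seq_gdominatedZ; exact: gdominated_seq an].
congr riint; apply/funext => v; rewrite mulN1r.
by case: (leP (h (rowv v)) 0) => h0; case: leP => h1; lra.
Qed.

End GaussianIntegral.

(** * Smooth convex functions *)

Section SmoothConvex.
Variable R : realType.
Variable d : nat.
Local Notation vec := 'rV[R]_d.
Implicit Types (u v w x y z : vec).

(* Baillon-Haddad: test the lower bound at [x] against the upper bound at [y],
   both at the point [y + L^-1 (m x - m y)]. *)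
Lemma cocoercive (psi : vec -> R) (m : vec -> vec) (L : R) : 0 < L ->
  (forall x y, psi x + dotp (m x) (y - x) <= psi y) ->
  (forall x y, psi y <= psi x + dotp (m x) (y - x) + L / 2 * dotp (y - x) (y - x)) ->
  forall x y, dotp (m x - m y) (m x - m y) <= L * dotp (m x - m y) (x - y).
Proof.
move=> L0 lo up.
have key x y : psi x + dotp (m x) (y - x) + (2 * L)^-1 * dotp (m x - m y) (m x - m y) <= psi y.
  set q := m x - m y; set w := y + L^-1 *: q.
  have h1 := lo x w; have h2 := up y w.
  have wx : w - x = (y - x) + L^-1 *: q by rewrite /w addrAC.
  have wy : w - y = L^-1 *: q by rewrite /w addrC addKr.
  rewrite wx dotpDr dotpZr in h1; rewrite wy !dotpZr dotpZl in h2.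
  have qq : dotp q q = dotp (m x) q - dotp (m y) q by rewrite {1}/q dotpDl dotpNl.
  have E : L / 2 * (L^-1 * (L^-1 * dotp q q)) = 2^-1 * (L^-1 * dotp q q).
    by field; rewrite gt_eqF.
  rewrite E in h2.
  have E2 : L^-1 * dotp (m x) q - L^-1 * dotp (m y) q = L^-1 * dotp q q.
    by rewrite qq mulrBr.
  rewrite invfM -mulrA; lra.
move=> x y; have h1 := key x y; have h2 := key y x.
have E : dotp (m y - m x) (m y - m x) = dotp (m x - m y) (m x - m y).
  by rewrite -opprB dotpNl dotpNr opprK.
rewrite E in h2; set Q := dotp (m x - m y) (m x - m y) in h1 h2 *.
have h3 : L^-1 * Q <= dotp (m x - m y) (x - y).
  have -> : dotp (m x - m y) (x - y) = - dotp (m x) (y - x) - dotp (m y) (x - y).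
    rewrite !dotpE; ring.
  have : (2 * L)^-1 * Q + (2 * L)^-1 * Q = L^-1 * Q.
    by field; rewrite gt_eqF.
  lra.
by rewrite -(ler_pM2l L0) mulrA mulfV ?gt_eqF// mul1r in h3.
Qed.

(* Midpoint convexity, iterated on [x + 2^-n w], reduces the claim to the upper bound at
   [x - 2^-n w], whose quadratic term vanishes in the limit. *)
Lemma midconvex_subgrad (theta : vec -> R) (q : vec -> vec) :
  (forall x y, 2 * theta (2^-1 *: (x + y)) <= theta x + theta y) ->
  (forall x y, theta y <= theta x + dotp (q x) (y - x) + 2^-1 * dotp (y - x) (y - x)) ->
  forall x y, theta x + dotp (q x) (y - x) <= theta y.
Proof.
move=> mid up x y; set w := y - x.
have xw : x + w = y by rewrite addrC subrK.
have half2 v : 2^-1 *: (v + v) = v.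
  rewrite -{1 2}[v]scale1r -scalerDl scalerA (_ : 2^-1 * (1 + 1) = 1) ?scale1r//.
  by field.
have halve n : 2 ^+ n * (theta (x + 2^-1 ^+ n *: w) - theta x) <= theta y - theta x.
  elim: n => [|n IH]; first by rewrite !expr0 mul1r scale1r xw.
  apply: le_trans IH; rewrite exprSr -mulrA ler_pM2l ?exprn_gt0//.
  have := mid x (x + 2^-1 ^+ n *: w).
  have -> : 2^-1 *: (x + (x + 2^-1 ^+ n *: w)) = x + 2^-1 ^+ n.+1 *: w.
    by rewrite addrA scalerDr scalerA -exprS half2.
  lra.
have low n : dotp (q x) w - 2^-1 ^+ n * (2^-1 * dotp w w) <= theta y - theta x.
  apply: le_trans (halve n); set t := 2^-1 ^+ n.
  have t0 : 0 < t by rewrite exprn_gt0.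
  have h1 := mid (x + t *: w) (x - t *: w).
  have E : 2^-1 *: (x + t *: w + (x - t *: w)) = x.
    by rewrite addrACA subrr addr0 half2.
  rewrite E in h1.
  have h2 := up x (x - t *: w).
  have E2 : x - t *: w - x = - (t *: w) by rewrite addrAC subrr add0r.
  rewrite E2 !(dotpNl, dotpNr) opprK !(dotpZl, dotpZr) in h2.
  have E3 : 2 ^+ n * t = 1 :> R by rewrite /t -exprMn mulfV// expr1n.
  have h3 : t * (dotp (q x) w - t * (2^-1 * dotp w w)) <= theta (x + t *: w) - theta x.
    by lra.
  have := ler_wpM2l (exprn_ge0 n (ler0n R 2)) h3.
  by rewrite [X in X <= _]mulrA E3 mul1r.
have L : dotp (q x) w - 2^-1 ^+ n * (2^-1 * dotp w w) @[n --> \oo] -->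
    dotp (q x) w - 0 * (2^-1 * dotp w w).
  apply: cvgB; first exact: cvg_cst.
  apply: cvgM; last exact: cvg_cst.
  by apply: cvg_expr; rewrite ger0_norm ?invr_ge0// invf_lt1// ltr1n.
rewrite mul0r subr0 in L.
have : dotp (q x) w <= theta y - theta x by apply: (cvgr_to_le L); exact: nearW.
lra.
Qed.

(** Subtracting the quadratic majorant from [g] along the segment leaves a function [F] whose
    derivative on [[0, 1]] is nonpositive by Cauchy-Schwarz and the Lipschitz bound; one mean value
    then gives [F 1 <= F 0]. *)
Lemma descent_dir (g : vec -> R) (L : R) x w : (forall z, differentiable g z) ->
  (forall x y, enorm (grad g x - grad g y) <= L * enorm (x - y)) ->
  g (x + w) <= g x + dotp (grad g x) w + L / 2 * dotp w w.
Proof.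
move=> dg Lg.
pose a := dotp (grad g x) w; pose b := L / 2 * dotp w w.
pose F (t : R) := g (x + t *: w) - (a * t + b * t ^+ 2).
have dF (t : R) : is_derive t 1 F (dotp (grad g (x + t *: w)) w - (a + 2 * b * t)).
  have d1 := @is_derive_grad_line _ _ g x w t (dg _).
  rewrite /F; apply: is_derive_eq; congr (_ - _).
  by transitivity (a * 1 + b * (t * 1 + t * 1)) => //; ring.
have cF : {within `[0, 1], continuous F}.
  by apply: derivable_within_continuous => t _; exact: ex_derive.
have [t] := MVT_segment ler01 (fun t _ => dF t) cF.
rewrite in_itv /= subr0 mulr1 => /andP[t0 t1].
have -> : F 0 = g x by rewrite /F scale0r addr0 expr0n !mulr0 addr0 subr0.
have -> : F 1 = g (x + w) - (a + b) by rewrite /F scale1r expr1n !mulr1.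
have h1 : dotp (grad g (x + t *: w)) w - a <= 2 * b * t.
  have -> : dotp (grad g (x + t *: w)) w - a = dotp (grad g (x + t *: w) - grad g x) w.
    by rewrite dotpDl dotpNl.
  apply: le_trans (dotp_le _ _) _.
  have h := Lg (x + t *: w) x.
  have E : x + t *: w - x = t *: w by rewrite addrAC subrr add0r.
  rewrite E enormZ ger0_norm// in h.
  have -> : 2 * b * t = L * (t * enorm w) * enorm w.
    by rewrite /b -enorm_sqr; field.
  by apply: ler_wpM2r h; exact: enorm_ge0.
rewrite -/a -/b; lra.
Qed.

Lemma descent (g : vec -> R) (L : R) x y : (forall z, differentiable g z) ->
  (forall x y, enorm (grad g x - grad g y) <= L * enorm (x - y)) ->
  g y <= g x + dotp (grad g x) (y - x) + L / 2 * dotp (y - x) (y - x).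
Proof.
move=> dg Lg; have := @descent_dir g L x (y - x) dg Lg.
by rewrite [x + _]addrC subrK.
Qed.

(** The sublevel set of [g x0] is closed and bounded, hence compact, and a minimiser on it is a
    global one. *)
Lemma exists_min_coercive (g : vec -> R) (x0 : vec) (r : R) : continuous g ->
  (forall x, g x <= g x0 -> enorm (x - x0) <= r) -> exists x, forall y, g x <= g y.
Proof.
move=> cg H; pose A := [set x : vec | g x <= g x0].
have cA : closed A by exact: (closed_comp (fun x _ => cg x) (@closed_le _ (g x0))).
have bA : bounded_set A.
  exists (r + `|x0|); split; first exact: num_real.
  move=> M rM x /H xr; apply/ltW/le_lt_trans/rM.
  rewrite -[x](subrK x0); apply: le_trans (ler_normD _ _) _; rewrite lerD2r.
  exact: le_trans (enorm_dist_norm _ _) xr.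
have [c cin cP] := @compact_EVT_min _ R g A (ex_intro _ x0 (lexx (g x0))) (bounded_closed_compact bA cA) (continuous_subspaceT cg).
exists c => y; have [yA|/ltW yA] := leP (g y) (g x0); first exact/cP/mem_set.
by apply: le_trans yA; apply/cP/mem_set; rewrite /A /=.
Qed.

End SmoothConvex.

(** * Differentiability and concavity of the log-density *)

Section LogDensity.
Variable R : realType.
Variable d : nat.
Local Notation vec := 'rV[R]_d.
Variable p : vec -> R.
Hypothesis p0 : forall x, 0 < p x.
Hypothesis dp : thrice_differentiable p.

Lemma is_derive_partial (g : vec -> R) i x : differentiable g x ->
  is_derive x (delta_mx 0 i) g (partial i g x).
Proof. by move=> dg; apply: derivableP; exact: diff_derivable. Qed.

Lemma differentiable_ln x : differentiable (fun z => ln (p z)) x.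
Proof.
case: dp => d1 _ _; apply: (@differentiable_comp _ _ _ _ p (@ln R)) => //.
by apply/derivable1_diffP; have [] := is_derive1_ln (p0 x).
Qed.

Lemma partial_ln i : partial i (fun z => ln (p z)) = (fun x => partial i p x * (p x)^-1).
Proof.
apply/funext => x; case: dp => d1 _ _.
have := is_derive_dir_comp (is_derive1_ln (p0 x)) (is_derive_partial i (d1 x)).
by move=> ?; rewrite mulrC; exact: derive_val.
Qed.

Lemma partial2_ln i j : partial j (partial i (fun z => ln (p z))) =
  (fun x => partial j (partial i p) x * (p x)^-1
            - partial i p x * partial j p x * ((p x)^-1 * (p x)^-1)).
Proof.
rewrite partial_ln; apply/funext => x; case: dp => d1 d2 _.
have h1 := is_derive_partial j (d1 x); have h2 := is_derive_partial j (d2 i x).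
have px : p x != 0 by rewrite gt_eqF.
have h3 := @is_derive_dir_comp _ _ (fun t => t^-1) p x (delta_mx 0 j) _ _
  (is_deriveV px (is_derive_id (p x) 1)) h1.
have := is_deriveM h2 h3 => h4.
transitivity (partial i p x * (- (p x) ^- 2 * 1 * partial j p x) +
  (p x)^-1 * partial j (partial i p) x); first exact: derive_val.
by rewrite mulr1; field; exact: px.
Qed.

(** The explicit first and second partials of [ln p] are combinations of differentiable partials of
    [p] and of [1 / p]. *)
Lemma thrice_differentiable_ln : thrice_differentiable (fun z => ln (p z)).
Proof.
case: (dp) => d1 d2 d3.
have dV x : differentiable (fun z => (p z)^-1) x.
  by apply: differentiableV => //; rewrite gt_eqF.
split; first exact: differentiable_ln.
  by move=> i x; rewrite partial_ln; exact: differentiableM.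
move=> i j x; rewrite partial2_ln; apply: differentiableB.
  exact: differentiableM.
by apply: (@differentiableM _ _ (fun x => partial i p x * partial j p x)); exact: differentiableM.
Qed.

Lemma convex_neg_ln : log_concave p -> convex_fun (fun z => - ln (p z)).
Proof. by move=> H x y t t01; have := H x y t t01; lra. Qed.

End LogDensity.

(** * Posterior means *)

Section Posterior.
Variable R : realType.
Variable d : nat.
Local Notation vec := 'rV[R]_d.
Implicit Types (u v w x y z : vec).
Variable l : vec -> R.
Variable M : R.
Hypothesis dl : thrice_differentiable l.
Hypothesis cl : convex_fun (fun z => - l z).
Hypothesis lM : forall x, third_deriv_frob l x <= M.

Lemma diff_l x : differentiable l x. Proof. by case: dl. Qed.

Lemma M_ge0 : 0 <= M. Proof. exact: le_trans (sqrtr_ge0 _) (lM 0). Qed.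

Lemma l_grad_le x y : l y <= l x + dotp (grad l x) (y - x).
Proof. by apply: concave_grad_le => //; exact: diff_l. Qed.

Lemma le_sum_term n (F : 'I_n -> R) i : (forall j, 0 <= F j) -> F i <= \sum_(j < n) F j.
Proof. by move=> F0; rewrite (bigD1 i)//= lerDl sumr_ge0. Qed.

(** Only the terms of the Frobenius sum with the two inner indices equal to [i] and [j] are kept. *)
Lemma enorm_grad_third i j x : enorm (grad (partial i (partial j l)) x) <= M.
Proof.
apply: le_trans (lM x); rewrite ler_wsqrtr//.
apply: ler_sum => k _; rewrite mxE.
have s0 (r : R) : 0 <= r ^+ 2 by exact: sqr_ge0.
apply: le_trans (le_sum_term j (fun j0 => s0 (partial k (partial i (partial j0 l)) x))) _.
apply: (le_sum_term (F := fun i0 => \sum_(k0 < d) partial k (partial i0 (partial k0 l)) x ^+ 2)).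
by move=> i0; apply: sumr_ge0.
Qed.

Lemma hess_lip i j x w :
  `|partial i (partial j l) (x + w) - partial i (partial j l) x| <= M * enorm w.
Proof.
case: dl => _ _ d3.
have [t _] := @mvt_sym _ _ _ 1 0 (fun t => @is_derive_grad_line _ _ _ x w t (d3 j i _)).
rewrite scale1r scale0r addr0 subr0 mulr1 => ->.
apply: le_trans (normr_dotp_le _ _) _; apply: ler_wpM2r; first exact: enorm_ge0.
exact: enorm_grad_third.
Qed.

(** Mean value theorem for [partial j l] on the segment, followed by [hess_lip] entry by entry. The
    factor [d] comes from bounding the Euclidean norm by the sum of the coordinates. *)
Lemma grad_taylor j x w :
  `|partial j l (x + w) - partial j l x - dotp (grad (partial j l) x) w|
    <= d%:R * M * dotp w w.
Proof.
case: dl => _ d2 _.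
have [t] := @mvt_sym _ _ _ 1 0 (fun t => @is_derive_grad_line _ _ _ x w t (d2 j _)).
rewrite scale1r scale0r addr0 !subr0 normr1 mulr1 => t1 ->.
rewrite -dotpNl -dotpDl; apply: le_trans (normr_dotp_le _ _) _.
rewrite -enorm_sqr expr2 mulrA; apply: ler_wpM2r; first exact: enorm_ge0.
apply: le_trans (enorm_le_sum _) _.
rewrite -mulrA mulr_natl -[X in _ *+ X]card_ord -sumr_const.
apply: ler_sum => k _; rewrite !mxE; apply: le_trans (hess_lip _ _ _ _) _.
rewrite ler_wpM2l ?M_ge0// enormZ ler_piMl ?enorm_ge0//.
Qed.

(** Unnormalised posterior density given the observation [z] at noise variance [s]; the Gaussian
    normalisation cancels in [pexp]. *)
Definition pweight (s : R) z x : R := expR (l x - (2 * s)^-1 * dotp (z - x) (z - x)).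

Lemma continuous_l : continuous l.
Proof. by move=> x; apply: differentiable_continuous; exact: diff_l. Qed.

(** Concavity puts [l] below its tangent at [z]; Young's inequality absorbs the linear term into
    half of the quadratic one, leaving [|x-z|^2 / (4s)]. Then [|x|^2 <= 2|x-z|^2 + 2|z|^2] recentres
    the decay at 0, whence the exponent [1 / (8s)]. *)
Lemma gdominated_pweight s z : 0 < s -> gdominated (pweight s z).
Proof.
move=> s0; split.
  move=> x; apply: (continuous_comp (f := fun x => l x - (2 * s)^-1 * dotp (z - x) (z - x))); last exact: continuous_expR.
  apply: continuousB; first exact: continuous_l.
  apply: continuousM; first exact: cst_continuous.
  by apply: continuous_dotp => {}x; apply: continuousB; [exact: cst_continuous|exact: cvg_id|exact: cst_continuous|exact: cvg_id].
set b := grad l z.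
exists (8 * s)^-1, (expR (l z + s * dotp b b + (4 * s)^-1 * dotp z z)); split.
  by rewrite invr_gt0 mulr_gt0.
move=> x; rewrite ger0_norm ?expR_ge0// -expRD ler_expR.
have h1 := l_grad_le z x.
have h2 := dotpp_ge0 ((x - z) - (2 * s) *: b).
have h3 := dotpp_ge0 ((x - z) - z).
rewrite -/b in h1.
have i0 : 0 < s^-1 by rewrite invr_gt0.
have E2 : dotp b (x - z) <= (4 * s)^-1 * dotp (x - z) (x - z) + s * dotp b b.
  move: (x - z) h2 => u h2.
  have := ler_wpM2l (ltW i0) h2.
  rewrite !dotpE (dotpC u b) mulr0.
  set Y := (X in 0 <= X).
  have -> : Y = 4 * ((4 * s)^-1 * dotp u u + s * dotp b b - dotp b u).
    by rewrite /Y; field; rewrite gt_eqF.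
  lra.
have E3 : dotp x x <= 2 * dotp (x - z) (x - z) + 2 * dotp z z.
  have := dotpp_ge0 (x - z - z); rewrite !dotpE (dotpC z x); lra.
have E4 : dotp (z - x) (z - x) = dotp (x - z) (x - z).
  by rewrite -opprB dotpNl dotpNr opprK.
have e8 : 0 <= (8 * s)^-1 by rewrite invr_ge0 mulr_ge0// ltW.
have E5 := ler_wpM2l e8 E3.
have E6 : (8 * s)^-1 * (2 * dotp (x - z) (x - z) + 2 * dotp z z) =
  (4 * s)^-1 * dotp (x - z) (x - z) + (4 * s)^-1 * dotp z z by field; rewrite gt_eqF.
have E7 : (2 * s)^-1 * dotp (x - z) (x - z) = 2 * ((4 * s)^-1 * dotp (x - z) (x - z)).
  by field; rewrite gt_eqF.
rewrite E4 E7; lra.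
Qed.

Lemma pweight_gt0 s z x : 0 < pweight s z x. Proof. exact: expR_gt0. Qed.

Lemma subgauss_partial j : subgauss (partial j l).
Proof.
case: dl => _ d2 _.
set a := `|partial j l 0|; set b := enorm (grad (partial j l) 0); set c := d%:R * M.
apply: (@subgauss_quadratic _ _ _ (a + b + c)); first by move=> x; apply: differentiable_continuous; exact: d2.
move=> x; have := grad_taylor j 0 x; rewrite add0r -/c => h.
have := normr_dotp_le (grad (partial j l) 0) x; rewrite -/b => h2.
have -> : partial j l x = (partial j l x - partial j l 0 - dotp (grad (partial j l) 0) x)
  + dotp (grad (partial j l) 0) x + partial j l 0 by ring.
apply: le_trans (ler_normD _ _) _; rewrite -/a; apply: le_trans (lerD (ler_normD _ _) (lexx a)) _.
have a0 : 0 <= a by exact: normr_ge0.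
have b0 : 0 <= b by exact: enorm_ge0.
have c0 : 0 <= c by rewrite mulr_ge0// M_ge0.
have x0 := enorm_ge0 x; rewrite -!enorm_sqr in h *.
have : enorm x <= 1 + enorm x ^+ 2 by have := sqr_ge0 (enorm x - 1); nra.
move=> h3; have := ler_wpM2l b0 h3; have := sqr_ge0 (enorm x); nra.
Qed.

Definition pmass s z : R := intV (pweight s z).
Definition pexp s z (phi : vec -> R) : R := intV (fun x => phi x * pweight s z x) / pmass s z.
Definition pmean s z : vec := \row_j pexp s z (fun x => x 0 j).

Section Expectation.
Variables (s : R) (z : vec).
Hypothesis s0 : 0 < s.

Lemma pmass_gt0 : 0 < pmass s z.
Proof. by apply: intV_gt0; [exact: gdominated_pweight|move=> x; exact: pweight_gt0]. Qed.

Lemma gdominated_mul_pweight phi : subgauss phi -> gdominated (fun x => phi x * pweight s z x).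
Proof. by move=> h; apply: gdominated_mul => //; exact: gdominated_pweight. Qed.

Lemma pexpD phi psi : subgauss phi -> subgauss psi ->
  pexp s z (fun x => phi x + psi x) = pexp s z phi + pexp s z psi.
Proof.
move=> h1 h2; rewrite /pexp -mulrDl -intVD; try exact: gdominated_mul_pweight.
by congr (_ / _); apply: intV_ext => x; rewrite mulrDl.
Qed.

Lemma pexpZ c phi : subgauss phi -> pexp s z (fun x => c * phi x) = c * pexp s z phi.
Proof.
move=> h1; rewrite /pexp mulrA -intVZ; last exact: gdominated_mul_pweight.
by congr (_ / _); apply: intV_ext => x; rewrite mulrA.
Qed.

Lemma pexp_cst c : pexp s z (fun=> c) = c.
Proof.
by rewrite /pexp intVZ ?mulfK//; [rewrite gt_eqF// pmass_gt0|exact: gdominated_pweight].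
Qed.

Lemma pexp_le phi psi : subgauss phi -> subgauss psi -> (forall x, phi x <= psi x) ->
  pexp s z phi <= pexp s z psi.
Proof.
move=> h1 h2 H; rewrite ler_pM2r ?invr_gt0 ?pmass_gt0//.
apply: le_intV; try exact: gdominated_mul_pweight.
by move=> x; rewrite ler_pM2r ?pweight_gt0.
Qed.

Lemma pexp_ext phi psi : phi =1 psi -> pexp s z phi = pexp s z psi.
Proof. by move=> /funext ->. Qed.

Lemma pexp_abs phi psi : subgauss phi -> subgauss psi -> (forall x, `|phi x| <= psi x) ->
  `|pexp s z phi| <= pexp s z psi.
Proof.
move=> h1 h2 H; rewrite ler_norml; apply/andP; split.
  rewrite lerNl -mulN1r -pexpZ//; apply: pexp_le => //; first by apply: subgaussM => //; exact: subgauss_cst.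
  by move=> x; rewrite mulN1r; have := H x; rewrite ler_norml => /andP[]; lra.
by apply: pexp_le => // x; apply: le_trans (H x); exact: ler_norm.
Qed.

Lemma pexp_sum (I : Type) (r : seq I) (F : I -> vec -> R) : (forall i, subgauss (F i)) ->
  pexp s z (fun x => \sum_(i <- r) F i x) = \sum_(i <- r) pexp s z (F i).
Proof.
move=> H; elim: r => [|i r IH].
  by rewrite big_nil -[RHS](pexp_cst 0); apply: pexp_ext => x; rewrite big_nil.
rewrite big_cons -IH -pexpD//; last exact: subgauss_sum.
by apply: pexp_ext => x; rewrite big_cons.
Qed.

Lemma is_derive_pweight j x :
  is_derive x (delta_mx 0 j) (pweight s z) (pweight s z x * (partial j l x + s^-1 * (z 0 j - x 0 j))).
Proof.
have h1 := is_derive_partial j (diff_l x).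
have h2 := is_derive_sqdist z x (delta_mx 0 j).
have h3 := is_deriveB h1 (is_deriveZ (2 * s)^-1 h2).
have := is_derive_dir_comp (is_derive_expR _) h3 => h4.
apply: is_derive_eq (h4) _; congr (_ * _).
rewrite dotp_delta !mxE -![_ *: _]/(_ * _); congr (_ + _).
by field; rewrite gt_eqF.
Qed.

Lemma subgauss_sub_coord j : subgauss (fun x => x 0 j - z 0 j).
Proof. by apply: subgaussD; [exact: subgauss_coord|exact: subgauss_cst]. Qed.

(** The integral of the [j]-th partial of [phi] times the weight vanishes, and the logarithmic
    derivative of the weight is [partial j l x + (z_j - x_j) / s]. *)
Lemma pexp_ibp j phi phi' : (forall x, is_derive x (delta_mx 0 j) phi (phi' x)) ->
  subgauss phi -> subgauss phi' ->
  pexp s z (fun x => phi x * (x 0 j - z 0 j)) =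
  s * (pexp s z phi' + pexp s z (fun x => phi x * partial j l x)).
Proof.
move=> dphi vp vp'.
have v1 : subgauss (fun x => phi x * partial j l x) by apply: subgaussM => //; exact: subgauss_partial.
have v2 : subgauss (fun x => phi x * (x 0 j - z 0 j)) by apply: subgaussM => //; exact: subgauss_sub_coord.
have v3 : subgauss (fun x => phi' x + phi x * partial j l x + - s^-1 * (phi x * (x 0 j - z 0 j))).
  by apply: subgaussD; [apply: subgaussD|apply: subgaussM => //; exact: subgauss_cst].
have : pexp s z (fun x => phi' x + phi x * partial j l x + - s^-1 * (phi x * (x 0 j - z 0 j))) = 0.
  rewrite /pexp [X in X / _](_ : _ = 0) ?mul0r//.
  apply: (@intV_ibp _ _ j (fun x => phi x * pweight s z x)); try exact: gdominated_mul_pweight.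
  move=> x; apply: is_derive_eq (is_deriveM (dphi x) (is_derive_pweight j x)) _.
  by rewrite -![_ *: _]/(_ * _); ring.
rewrite pexpD ?pexpD ?pexpZ//; last 2 first.
- exact: subgaussD.
- by apply: subgaussM => //; exact: subgauss_cst.
move=> H; apply: (@mulfI _ s^-1); first by rewrite invr_eq0 gt_eqF.
rewrite [RHS]mulrA mulVf ?gt_eqF// mul1r; lra.
Qed.

Lemma pexp_coord j : pexp s z (fun x => x 0 j - z 0 j) = s * pexp s z (partial j l).
Proof.
have := @pexp_ibp j (fun=> 1) (fun=> 0) (fun x => is_derive_cst _ _ _) (subgauss_cst _ _) (subgauss_cst _ _).
rewrite pexp_cst add0r => H; rewrite -(pexp_ext (phi := fun x => 1 * (x 0 j - z 0 j))) ?H.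
  by congr (_ * _); apply: pexp_ext => x; rewrite mul1r.
by move=> x; rewrite mul1r.
Qed.

Lemma is_derive_coord (x : vec) j : is_derive x (delta_mx 0 j) (fun x : vec => x 0 j - z 0 j) 1.
Proof.
apply: is_derive_of_line.
have -> : (fun t : R => (x + t *: delta_mx 0 j) 0 j - z 0 j) = (fun t : R => t + (x 0 j - z 0 j)).
  by apply/funext => t; rewrite !mxE !eqxx /= mulr1; ring.
by apply: is_derive_eq; rewrite addr0.
Qed.

Lemma subgauss_sqdist : subgauss (fun x => dotp (x - z) (x - z)).
Proof.
apply: (@subgauss_sum _ _ _ _ (fun i x => (x - z) 0 i * (x - z) 0 i)) => i.
by under eq_fun do rewrite !mxE; apply: subgaussM; exact: subgauss_sub_coord.
Qed.

Lemma subgauss_dotp b : subgauss (fun x => dotp b (x - z)).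
Proof.
apply: (@subgauss_sum _ _ _ _ (fun i x => b 0 i * (x - z) 0 i)) => i.
under eq_fun do rewrite !mxE; apply: subgaussM; first exact: subgauss_cst.
exact: subgauss_sub_coord.
Qed.

Lemma subgaussZ c phi : subgauss phi -> subgauss (fun x : vec => c * phi x).
Proof. by move=> h; apply: subgaussM => //; exact: subgauss_cst. Qed.

(** Integration by parts with [phi = x_j - z_j], summed over [j], gives
    [V = s d + s E<grad l x, x - z>]. Monotonicity of the gradient of a concave function replaces
    [grad l x] by [grad l z], and Young's inequality leaves [V / 2] on the right, to be absorbed. *)
Lemma pexp_sqdist_le : pexp s z (fun x => dotp (x - z) (x - z)) <=
  2 * s * d%:R + s ^+ 2 * dotp (grad l z) (grad l z).
Proof.
set V := pexp s z _; set b := grad l z.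
have vg j : subgauss (fun x => (x 0 j - z 0 j) * partial j l x).
  by apply: subgaussM; [exact: subgauss_sub_coord|exact: subgauss_partial].
have vG : subgauss (fun x => dotp (grad l x) (x - z)).
  have := subgauss_sum (index_enum 'I_d) vg; congr subgauss; apply/funext => x.
  by apply: eq_bigr => j _; rewrite !mxE mulrC.
have VE : V = s * d%:R + s * pexp s z (fun x => dotp (grad l x) (x - z)).
  transitivity (\sum_(j < d) pexp s z (fun x => (x 0 j - z 0 j) * (x 0 j - z 0 j))).
    rewrite -pexp_sum; last by move=> j; apply: subgaussM; exact: subgauss_sub_coord.
    by apply: pexp_ext => x; apply: eq_bigr => j _; rewrite !mxE.
  under eq_bigr do rewrite (@pexp_ibp _ _ (fun=> 1) (fun x => is_derive_coord x _) (subgauss_sub_coord _) (subgauss_cst _ _)) pexp_cst.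
  rewrite -mulr_sumr -mulrDr big_split /= sumr_const card_ord -pexp_sum//; congr (_ * (_ + _)).
  by apply: pexp_ext => x; apply: eq_bigr => j _; rewrite !mxE mulrC.
have Hb : pexp s z (fun x => s * dotp (grad l x) (x - z)) <=
    pexp s z (fun x => 2^-1 * dotp (x - z) (x - z) + s ^+ 2 / 2 * dotp b b).
  apply: pexp_le; first exact: subgaussZ.
    by apply: subgaussD; [apply: subgaussZ; exact: subgauss_sqdist|exact: subgauss_cst].
  move=> x; have h1 := l_grad_le z x; have h2 := l_grad_le x z.
  rewrite -/b in h1.
  have h3 : dotp (grad l x) (x - z) <= dotp b (x - z).
    by rewrite -[z - x]opprB dotpNr in h2; lra.
  have h4 := dotpp_ge0 ((x - z) - s *: b).
  move: (x - z) h3 h4 => u h3 h4.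
  rewrite !dotpE (dotpC u b) in h4.
  have := ler_wpM2l (ltW s0) h3; lra.
rewrite pexpZ// pexpD ?pexp_cst ?pexpZ -/V in Hb; try exact: subgauss_cst; try exact: subgauss_sqdist; try (apply: subgaussZ; exact: subgauss_sqdist).
by rewrite -/V; lra.
Qed.

(** By [pexp_coord], coordinate [j] of the bias is [s E[partial j l x - partial j l z]]. The linear
    Taylor term has expectation of order [s] because the mean displacement has, and the remainder is
    controlled by the second moment, at most [s V1]. *)
Lemma pmean_bias (Q V1 : R) : 0 <= V1 ->
  (forall j, `|partial j l z| <= Q) -> (forall j, enorm (grad (partial j l) z) <= Q) ->
  d%:R * M <= Q -> pexp s z (fun x => dotp (x - z) (x - z)) <= s * V1 ->
  enorm (pmean s z - z - s *: grad l z) <=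
    s ^+ 2 * (d%:R * (2 * d%:R * Q ^+ 2 * (1 + s * V1) + Q * V1)).
Proof.
set V := pexp s z _ => V10 bQ hQ MQ VV.
have Q0 : 0 <= Q by apply: le_trans MQ; rewrite mulr_ge0// M_ge0.
(* A crude global bound suffices here: it only serves to show that the mean displacement is of order
   [s]. *)
have glob j x : `|partial j l x| <= 2 * Q * (1 + dotp (x - z) (x - z)).
  have h := grad_taylor j z (x - z); rewrite [z + _]addrC subrK in h.
  have h2 := normr_dotp_le (grad (partial j l) z) (x - z).
  have -> : partial j l x = (partial j l x - partial j l z - dotp (grad (partial j l) z) (x - z))
    + dotp (grad (partial j l) z) (x - z) + partial j l z by ring.
  apply: le_trans (ler_normD _ _) _; apply: le_trans (lerD (ler_normD _ _) (bQ j)) _.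
  have x0 := enorm_ge0 (x - z); rewrite -!enorm_sqr in h *.
  set e := enorm (x - z) in h h2 x0 *.
  have h3 : enorm (grad (partial j l) z) * e <= Q * e by rewrite ler_wpM2r.
  have h4 : d%:R * M * e ^+ 2 <= Q * e ^+ 2 by rewrite ler_wpM2r// sqr_ge0.
  have := mulr_ge0 Q0 (sqr_ge0 (e - 1)); have := mulr_ge0 Q0 (sqr_ge0 e); nra.
have vq (a c : R) : subgauss (fun x => a * (c + dotp (x - z) (x - z))).
  by apply: subgaussZ; apply: subgaussD; [exact: subgauss_cst|exact: subgauss_sqdist].
have Euj j : `|pexp s z (fun x => x 0 j - z 0 j)| <= s * (2 * Q * (1 + s * V1)).
  rewrite pexp_coord normrM gtr0_norm// ler_pM2l//.
  apply: le_trans (pexp_abs (subgauss_partial j) (vq (2 * Q) 1) (glob j)) _.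
  rewrite pexpZ ?pexpD ?pexp_cst; try exact: subgauss_cst; try exact: subgauss_sqdist.
    by rewrite ler_wpM2l ?mulr_ge0// lerD2l.
  by apply: subgaussD; [exact: subgauss_cst|exact: subgauss_sqdist].
have Edot b : enorm b <= Q -> `|pexp s z (fun x => dotp b (x - z))| <= s * (2 * d%:R * Q ^+ 2 * (1 + s * V1)).
  move=> bq; have -> : pexp s z (fun x => dotp b (x - z)) = \sum_(j < d) b 0 j * pexp s z (fun x => x 0 j - z 0 j).
    under eq_bigr do (rewrite -pexpZ; last exact: subgauss_sub_coord).
    rewrite -pexp_sum; last by move=> j; apply: subgaussZ; exact: subgauss_sub_coord.
    by apply: pexp_ext => x; apply: eq_bigr => j _; rewrite !mxE.
  apply: le_trans (ler_norm_sum _ _ _) _.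
  apply: (@le_trans _ _ (\sum_(j < d) Q * (s * (2 * Q * (1 + s * V1))))).
    apply: ler_sum => j _; rewrite normrM; apply: ler_pM => //.
    exact: le_trans (normr_coord_le _ _) bq.
  by rewrite sum_cst le_eqVlt; apply/orP; left; apply/eqP; ring.
have coord j : `|(pmean s z - z - s *: grad l z) 0 j| <=
    s ^+ 2 * (2 * d%:R * Q ^+ 2 * (1 + s * V1) + Q * V1).
  have -> : (pmean s z - z - s *: grad l z) 0 j =
      s * pexp s z (fun x => partial j l x + - partial j l z).
    rewrite pexpD ?pexp_cst; [|exact: subgauss_partial|exact: subgauss_cst].
    rewrite mulrDr -pexp_coord pexpD ?pexp_cst; [|exact: subgauss_coord|exact: subgauss_cst].
    by rewrite !mxE mulrN.
  rewrite normrM gtr0_norm// expr2 -mulrA ler_pM2l//.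
  pose g := grad (partial j l) z.
  have vr : subgauss (fun x => partial j l x + - partial j l z + -1 * dotp g (x - z)).
    apply: subgaussD; last by apply: subgaussZ; exact: subgauss_dotp.
    by apply: subgaussD; [exact: subgauss_partial|exact: subgauss_cst].
  have -> : pexp s z (fun x => partial j l x + - partial j l z) =
    pexp s z (fun x => partial j l x + - partial j l z + -1 * dotp g (x - z)) + pexp s z (fun x => dotp g (x - z)).
    by rewrite -pexpD//; [apply: pexp_ext => x; ring|exact: subgauss_dotp].
  apply: le_trans (ler_normD _ _) _; rewrite [leLHS]addrC mulrDr; apply: lerD; first exact: Edot (hQ j).
  apply: le_trans (pexp_abs vr (subgaussZ Q subgauss_sqdist) _) _.
    move=> x; rewrite mulN1r; apply: le_trans (ler_wpM2r (dotpp_ge0 (x - z)) MQ).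
    by have := grad_taylor j z (x - z); rewrite [z + _]addrC subrK.
  by rewrite pexpZ; [rewrite [X in _ <= X]mulrCA ler_wpM2l|exact: subgauss_sqdist].
apply: le_trans (enorm_le_sum _) _; apply: le_trans (ler_sum _ (fun j _ => coord j)) _.
by rewrite sum_cst le_eqVlt; apply/orP; left; apply/eqP; ring.
Qed.

End Expectation.

(** The pointwise Prékopa-Leindler hypothesis follows from midpoint concavity of [l] and midpoint
    convexity of the squared norm. *)
Lemma pmass_midpoint s x y : 0 < s -> pmass s x * pmass s y <= pmass s (2^-1 *: (x + y)) ^+ 2.
Proof.
move=> s0; apply: intV_PL; try exact: gdominated_pweight; try by move=> ?; exact: pweight_gt0.
move=> u v; rewrite expr2 /pweight -!expRD ler_expR.
have h1 : l u + l v <= 2 * l (2^-1 *: (u + v)).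
  have := cl u v (t := 2^-1); rewrite invr_ge0 ler0n invf_le1// ler1n => /(_ isT).
  have -> : 1 - 2^-1 = 2^-1 :> R by field.
  rewrite -scalerDr; lra.
have h2 : 2 * dotp (2^-1 *: (x + y) - 2^-1 *: (u + v)) (2^-1 *: (x + y) - 2^-1 *: (u + v)) <=
    dotp (x - u) (x - u) + dotp (y - v) (y - v).
  rewrite -scalerBr opprD addrACA; move: (x - u) (y - v) => a b.
  have := dotpp_ge0 (a - b); rewrite !dotpE (dotpC b a); lra.
have i0 : 0 <= (2 * s)^-1 by rewrite invr_ge0 mulr_ge0// ltW.
have := ler_wpM2l i0 h2; lra.
Qed.

Lemma pmean_nonexpansive s x y : 0 < s -> enorm (pmean s x - pmean s y) <= enorm (x - y).
Proof.
move=> s0; pose psi z := 2^-1 * dotp z z + s * ln (pmass s z).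
have lo z z' : psi z + dotp (pmean s z) (z' - z) <= psi z'.
  set m := pmean s z.
  (* The weights at [z'] and [z] have ratio [exp(k + t)], where [t] has posterior mean 0 at [z];
     then [1 + t <= exp t] integrates to [H], whose logarithm is the subgradient inequality. *)
  pose k := (2 * s)^-1 * (dotp z z - dotp z' z') + s^-1 * dotp m (z' - z).
  have H : expR k * pmass s z <= pmass s z'.
    have v1 : subgauss (fun x : vec => expR k * (1 + s^-1 * dotp (z' - z) (x - m))).
      by apply: subgaussZ; apply: subgaussD; [exact: subgauss_cst|apply: subgaussZ; exact: subgauss_dotp].
    have -> : expR k * pmass s z = intV (fun x => expR k * (1 + s^-1 * dotp (z' - z) (x - m)) * pweight s z x).
      have : pexp s z (fun x => expR k * (1 + s^-1 * dotp (z' - z) (x - m))) = expR k.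
        rewrite pexpZ//; last by apply: subgaussD; [exact: subgauss_cst|apply: subgaussZ; exact: subgauss_dotp].
        rewrite pexpD ?pexp_cst ?pexpZ//; try exact: subgauss_cst; try exact: subgauss_dotp; try (apply: subgaussZ; exact: subgauss_dotp).
        suff -> : pexp s z (fun x => dotp (z' - z) (x - m)) = 0 by rewrite mulr0 addr0 mulr1.
        transitivity (\sum_(j < d) (z' - z) 0 j * pexp s z (fun x => x 0 j - m 0 j)).
          under eq_bigr do (rewrite -pexpZ//; last exact: subgauss_sub_coord).
          rewrite -pexp_sum//; last by move=> j; apply: subgaussZ; exact: subgauss_sub_coord.
          by apply: pexp_ext => x0; apply: eq_bigr => j _; rewrite !mxE.
        apply: big1 => j _; rewrite pexpD ?pexp_cst//; [|exact: subgauss_coord|exact: subgauss_cst].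
        by rewrite [m 0 j]mxE subrr mulr0.
      by move=> H0; rewrite -{1}H0 /pexp divfK// gt_eqF// pmass_gt0.
    apply: le_intV; [exact: gdominated_mul_pweight|exact: gdominated_pweight|move=> x0].
    pose t := s^-1 * dotp (z' - z) (x0 - m).
    have -> : pweight s z' x0 = expR (k + t) * pweight s z x0.
      rewrite /pweight -expRD; congr expR; rewrite /k /t.
      rewrite !dotpE (dotpC x0 z) (dotpC x0 z') (dotpC m z) (dotpC m z').
      by field; rewrite gt_eqF.
    apply: ler_wpM2r; first exact/ltW/pweight_gt0.
    by rewrite [expR (k + t)]expRD; exact: ler_wpM2l (expR_ge0 k) _ _ (expR_ge1Dx t).
  have Z1 := pmass_gt0 z s0; have Z2 := pmass_gt0 z' s0.
  have := H; rewrite -ler_ln ?posrE ?mulr_gt0 ?expR_gt0// lnM ?posrE ?expR_gt0// expRK => H2.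
  have := ler_wpM2l (ltW s0) H2; rewrite mulrDr.
  have -> : s * k = 2^-1 * (dotp z z - dotp z' z') + dotp m (z' - z) by rewrite /k; field; rewrite gt_eqF.
  rewrite /psi; lra.
(* This is [|z|^2 / 2 - psi z]. Midpoint convexity comes from [pmass_midpoint], the quadratic upper
   bound restates [lo], and the resulting subgradient inequality is the upper bound on [psi] with
   constant 1. *)
pose theta z := - (s * ln (pmass s z)).
have sub z z' : theta z + dotp (z - pmean s z) (z' - z) <= theta z'.
  have sq (a b : vec) : 2^-1 * dotp b b = 2^-1 * dotp a a + dotp a (b - a) + 2^-1 * dotp (b - a) (b - a).
    by rewrite !dotpE (dotpC b a); field.
  apply: (@midconvex_subgrad _ _ theta (fun z => z - pmean s z)) => {z z'} u v.
    have Z1 := pmass_gt0 u s0; have Z2 := pmass_gt0 v s0; have Z3 := pmass_gt0 (2^-1 *: (u + v)) s0.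
    have : ln (pmass s u * pmass s v) <= ln (pmass s (2^-1 *: (u + v)) ^+ 2).
      by rewrite ler_ln ?posrE ?pmass_midpoint// ?mulr_gt0// exprn_gt0.
    rewrite (lnM Z1 Z2) (lnXn 2 Z3) => /(ler_wpM2l (ltW s0)).
    by rewrite /theta mulr2n; move: (ln _) (ln _) (ln _) => e1 e2 e3; lra.
  have := lo u v; have := sq u v; rewrite /psi /theta [dotp (u - _) _]dotpDl dotpNl; lra.
have up z z' : psi z' <= psi z + dotp (pmean s z) (z' - z) + 1 / 2 * dotp (z' - z) (z' - z).
  have sq (a b : vec) : 2^-1 * dotp b b = 2^-1 * dotp a a + dotp a (b - a) + 2^-1 * dotp (b - a) (b - a).
    by rewrite !dotpE (dotpC b a); field.
  have := sub z z'; have := sq z z'; rewrite /psi /theta [dotp (z - _) _]dotpDl dotpNl; lra.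
have := cocoercive ltr01 lo up x y; rewrite mul1r => H.
have := le_trans H (dotp_le _ _); rewrite -enorm_sqr expr2.
have [-> _|n0] := eqVneq (enorm (pmean s x - pmean s y)) 0; first exact: enorm_ge0.
by rewrite ler_pM2l// lt_neqAle eq_sym n0 enorm_ge0.
Qed.

Lemma bias_uniform (tau : R) x0 (rho : R) : 0 < tau -> 0 <= rho ->
  exists B G : R, [/\ 0 <= B, 0 <= G & forall x, enorm (x - x0) <= rho ->
    enorm (grad l x) <= G /\
    forall s, 0 < s <= tau -> enorm (pmean s x - x - s *: grad l x) <= s ^+ 2 * B].
Proof.
move=> t0 r0.
have M0 := M_ge0; have d0 : 0 <= (d%:R : R) by [].
pose a := \sum_(j < d) `|partial j l x0|.
pose h := \sum_(j < d) enorm (grad (partial j l) x0).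
(* One constant for three bounds: first partials on the ball, [a + h rho + d M rho^2]; gradients of
   the partials, [h + d M rho]; and [d M] itself. *)
pose Q := a + h * (1 + rho) + d%:R * M * (1 + rho + rho ^+ 2).
have a0 : 0 <= a by apply: sumr_ge0.
have h0 : 0 <= h by apply: sumr_ge0 => *; exact: enorm_ge0.
have dM0 : 0 <= d%:R * M by rewrite mulr_ge0.
have q0 := sqr_ge0 rho.
have Q0 : 0 <= Q by rewrite !addr_ge0// mulr_ge0// !addr_ge0.
have MQ : d%:R * M <= Q.
  by rewrite /Q; have := mulr_ge0 h0 r0; have := mulr_ge0 dM0 r0; have := mulr_ge0 dM0 q0; nra.
have aj j : `|partial j l x0| <= a by apply: (le_sum_term j (F := fun j => `|partial j l x0|)).
have hj j : enorm (grad (partial j l) x0) <= h.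
  by apply: (le_sum_term j (F := fun j => enorm (grad (partial j l) x0))) => ?; exact: enorm_ge0.
have bQ j x : enorm (x - x0) <= rho -> `|partial j l x| <= Q.
  move=> xr; have h1 := grad_taylor j x0 (x - x0); rewrite [x0 + _]addrC subrK in h1.
  have h2 := normr_dotp_le (grad (partial j l) x0) (x - x0).
  have -> : partial j l x = (partial j l x - partial j l x0 - dotp (grad (partial j l) x0) (x - x0))
    + dotp (grad (partial j l) x0) (x - x0) + partial j l x0 by ring.
  apply: le_trans (ler_normD _ _) _; apply: le_trans (lerD (ler_normD _ _) (aj j)) _.
  have h3 : enorm (grad (partial j l) x0) * enorm (x - x0) <= h * rho.
    by apply: ler_pM => //; exact: enorm_ge0.
  have h4 : d%:R * M * dotp (x - x0) (x - x0) <= d%:R * M * rho ^+ 2.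
    by rewrite ler_wpM2l// -enorm_sqr ler_pXn2r// nnegrE enorm_ge0.
  rewrite /Q; have := mulr_ge0 dM0 r0; lra.
have hQ j x : enorm (x - x0) <= rho -> enorm (grad (partial j l) x) <= Q.
  move=> xr; rewrite -[grad _ x](subrK (grad (partial j l) x0)).
  apply: le_trans (enorm_triangle _ _) _; apply: le_trans (lerD _ (hj j)) _.
    apply: le_trans (enorm_le_sum _) _.
    apply: (@le_trans _ _ (\sum_(i < d) M * rho)).
      apply: ler_sum => i _; rewrite !mxE.
      have := hess_lip i j x0 (x - x0); rewrite [x0 + _]addrC subrK.
      by move=> /le_trans; apply; rewrite ler_wpM2l.
    by rewrite sum_cst mulrA.
  rewrite /Q; have := mulr_ge0 h0 r0; have := mulr_ge0 dM0 q0; lra.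
(* The bound [2 s d + s^2 |grad l x|^2] is at most [s V1], because [s <= tau] and
   [|grad l x|^2 <= d Q^2]. *)
clearbody Q; pose V1 := 2 * d%:R + tau * (d%:R * Q ^+ 2).
have V10 : 0 <= V1.
  by rewrite addr_ge0// ?mulr_ge0// ?sqr_ge0// ltW.
exists (d%:R * (2 * d%:R * Q ^+ 2 * (1 + tau * V1) + Q * V1)), (d%:R * Q); split.
- by rewrite mulr_ge0// addr_ge0// ?mulr_ge0// ?sqr_ge0// addr_ge0// mulr_ge0// ltW.
- exact: mulr_ge0.
move=> x xr; split.
  apply: le_trans (enorm_le_sum _) _.
  apply: (@le_trans _ _ (\sum_(i < d) Q)); last by rewrite sum_cst.
  by apply: ler_sum => i _; rewrite mxE; exact: bQ.
move=> s /andP[s0 st].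
have V : pexp s x (fun y => dotp (y - x) (y - x)) <= s * V1.
  apply: le_trans (pexp_sqdist_le x s0) _.
  have gg : dotp (grad l x) (grad l x) <= d%:R * Q ^+ 2.
    apply: (@le_trans _ _ (\sum_(i < d) Q ^+ 2)); last by rewrite sum_cst.
    apply: ler_sum => i _; rewrite mxE -expr2 -[leLHS]real_normK ?num_real//.
    by rewrite ler_pXn2r// ?nnegrE//; exact: bQ.
  have h1 : s ^+ 2 * dotp (grad l x) (grad l x) <= s ^+ 2 * (d%:R * Q ^+ 2).
    by rewrite ler_wpM2l// sqr_ge0.
  have h2 : s * (s * (d%:R * Q ^+ 2)) <= s * (tau * (d%:R * Q ^+ 2)).
    by apply: ler_wpM2l; [exact: ltW|apply: ler_wpM2r => //; rewrite mulr_ge0// sqr_ge0].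
  rewrite /V1; lra.
have Hb := pmean_bias s0 V10 (fun j => bQ j x xr) (fun j => hQ j x xr) MQ V.
apply: le_trans Hb _.
rewrite ler_wpM2l ?sqr_ge0// ler_wpM2l// lerD2r ler_wpM2l ?mulr_ge0 ?sqr_ge0//.
by rewrite lerD2l ler_wpM2r.
Qed.

End Posterior.

(** * Rates of convergence *)

Section Rates.
Variable R : realType.

Definition harm (n : nat) : R := \sum_(i < n) i.+1%:R^-1.

Lemma ln_le_sub1 (x : R) : 0 < x -> ln x <= x - 1.
Proof.
move=> x0; have {1}-> : x = 1 + (x - 1) by rewrite addrC subrK.
by apply: le_ln1Dx; lra.
Qed.

Lemma harm_le n : (0 < n)%N -> harm n <= 1 + ln n%:R.
Proof.
elim: n => [//|[|n] IH] _; rewrite /harm big_ord_recr /=.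
  by rewrite big_ord0 add0r invr1 ln1 addr0.
apply: le_trans (lerD (IH isT) (lexx _)) _; rewrite -addrA lerD2l.
have a0 : 0 < (n.+1%:R : R) by rewrite ltr0n.
have b0 : 0 < (n.+2%:R : R) by rewrite ltr0n.
have := @ln_le_sub1 (n.+1%:R / n.+2%:R); rewrite divr_gt0// => /(_ isT).
rewrite ln_div ?posrE//.
have -> : n.+1%:R / n.+2%:R - 1 = - n.+2%:R^-1 :> R.
  have -> : n.+1%:R = n.+2%:R - 1 :> R by rewrite -[n.+2]addn1 natrD addrK.
  by field; rewrite gt_eqF.
move: (n.+2%:R^-1) (ln n.+1%:R) (ln n.+2%:R) => a b c; lra.
Qed.

Definition rate (eta : R) (k : nat) : R := (1 + ln k%:R) / powR k%:R (1 + eta).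

Lemma ln_nat_ge0 k : (0 < k)%N -> 0 <= ln (k%:R : R).
Proof. by move=> k0; apply: ln_ge0; rewrite ler1n. Qed.

Lemma rate_ge0 eta k : (0 < k)%N -> 0 <= rate eta k.
Proof. by move=> k0; rewrite divr_ge0 ?powR_ge0// addr_ge0// ln_nat_ge0. Qed.

(** Truncation gives [n <= c k^(1+eta) < n + 1]: the first inequality bounds [ln n] by a multiple of
    [1 + ln k], the second bounds the denominator. [G] is chosen before [A] and [B], so it serves
    every centre of the inner iteration. *)
Lemma n_iter_rate (c eta : R) : 0 < c -> 0 < eta -> exists2 G : R, 0 <= G &
  forall (A B : R) k, 0 <= A -> 0 <= B -> (0 < k)%N ->
  (A + B * harm (n_iter c eta k)) / (n_iter c eta k).+1%:R <= (A + B * G) / c * rate eta k.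
Proof.
move=> c0 e0; exists (1 + `|ln c| + (1 + eta)); first by rewrite !addr_ge0// ltW.
move=> A B k A0 B0 k0; set n := n_iter c eta k; set G := _ + (1 + eta).
have kR : 0 < (k%:R : R) by rewrite ltr0n.
have lk := ln_nat_ge0 k0.
pose K := powR (k%:R : R) (1 + eta); have K0 : 0 < K by exact: powR_gt0.
have X0 : 0 < c * K by rewrite mulr_gt0.
have [nX Xn] : n%:R <= c * K /\ c * K < n.+1%:R.
  by have /andP[] := truncn_itv (ltW X0).
have HG : harm n <= G * (1 + ln k%:R).
  (* For small [c] there may be no inner step at all; the harmonic sum is then empty. *)
  have [n0|n0] := posnP n.
    by rewrite n0 /harm big_ord0 mulr_ge0// ?addr_ge0// ltW.
  apply: le_trans (harm_le n0) _.
  have h : ln n%:R <= ln c + (1 + eta) * ln k%:R.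
    rewrite -(ln_powR k%:R) -lnM ?posrE// ler_ln ?posrE ?ltr0n//.
  have h2 := ler_norm (ln c); have h3 := mulr_ge0 (normr_ge0 (ln c)) lk.
  rewrite /G; nra.
rewrite /rate -/K ler_pdivrMr ?ltr0n//.
have -> : (A + B * G) / c * ((1 + ln k%:R) / K) * n.+1%:R =
  (A + B * G) * (1 + ln k%:R) * (n.+1%:R / (c * K)) by field; rewrite !gt_eqF.
have h1 : 1 <= n.+1%:R / (c * K) by rewrite ler_pdivlMr// mul1r ltW.
have h2 : A + B * harm n <= (A + B * G) * (1 + ln k%:R).
  have := ler_wpM2l B0 HG; have := mulr_ge0 A0 lk; lra.
apply: le_trans h2 _; rewrite ler_peMr// mulr_ge0// ?addr_ge0// ?mulr_ge0//.
by rewrite /G !addr_ge0// ltW.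
Qed.

(** Discrete integral test: with [y = n + 1], [exp u >= 1 + u] and [ln x <= x - 1] give
    [(n / y)^(-b) >= 1 + b / y], which is then multiplied by [y^(-b)]. *)
Lemma powR_telescope (b : R) n : 0 < b -> (0 < n)%N ->
  powR n.+1%:R (- (1 + b)) <= b^-1 * (powR n%:R (- b) - powR n.+1%:R (- b)).
Proof.
move=> b0 n0; have a0 : 0 < (n%:R : R) by rewrite ltr0n.
have y0 : 0 < (n.+1%:R : R) by rewrite ltr0n.
rewrite /powR !gt_eqF//; set y := n.+1%:R : R.
rewrite opprD mulrDl mulN1r expRD expRN lnK ?posrE//.
rewrite -(ler_pM2l b0) mulrA mulrA mulfV ?gt_eqF// mul1r lerBrDr.
have -> : expR (- b * ln n%:R) = expR (- b * ln (n%:R / y)) * expR (- b * ln y).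
  by rewrite -expRD -mulrDr -lnM ?posrE ?divr_gt0// divfK// gt_eqF.
rewrite -[X in _ + X]mul1r -mulrDl ler_pM2r ?expR_gt0//.
apply: le_trans (expR_ge1Dx (- b * ln (n%:R / y))).
have := @ln_le_sub1 (n%:R / y); rewrite divr_gt0// => /(_ isT).
have -> : n%:R / y - 1 = - y^-1 :> R.
  have -> : n%:R = y - 1 :> R by rewrite /y -addn1 natrD addrK.
  by field; rewrite gt_eqF.
move=> /(ler_wpM2l (ltW b0)); move: (y^-1) (ln _) => q r; lra.
Qed.

(** Half of [eta] absorbs the logarithm: with [b = eta / 2], [1 + ln k <= (1 + 1/b) k^b]. The
    remaining exponent [- (1 + b)] telescopes. *)
Lemma sum_rate_le (eta : R) : 0 < eta -> exists2 S : R, 0 <= S &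
  forall n, \sum_(1 <= k < n.+1) rate eta k <= S.
Proof.
move=> e0; pose b := eta / 2; have b0 : 0 < b by rewrite divr_gt0.
have bV : 0 <= b^-1 by rewrite invr_ge0 ltW.
have rb k : (0 < k)%N -> rate eta k <= (1 + b^-1) * powR k%:R (- (1 + b)).
  move=> k0; have kR : 0 < (k%:R : R) by rewrite ltr0n.
  rewrite /rate -powRN.
  have -> : - (1 + b) = b + - (1 + eta) by rewrite /b; lra.
  rewrite powRD; last by apply/implyP => _; rewrite gt_eqF.
  rewrite mulrA ler_pM2r ?powR_gt0//.
  have h1 : 1 <= powR k%:R b by rewrite -[X in X <= _](powRr0 k%:R) ler_powR ?ler1n// ltW.
  have h2 : b * ln k%:R <= powR k%:R b.
    by rewrite -ln_powR; have := @ln_le_sub1 (powR k%:R b); rewrite powR_gt0// => /(_ isT); lra.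
  have := ler_wpM2l bV h2; rewrite mulrA mulVf ?gt_eqF// mul1r; lra.
exists ((1 + b^-1) * (1 + b^-1)); first by rewrite mulr_ge0// addr_ge0.
have tel n : \sum_(1 <= k < n.+2) powR (k%:R : R) (- (1 + b)) <= 1 + b^-1 * (1 - powR n.+1%:R (- b)).
  elim: n => [|n IH]; first by rewrite big_nat1 !powR1 subrr mulr0 addr0.
  rewrite big_nat_recr //=; have := @powR_telescope b n.+1 b0 isT; lra.
move=> [|n]; first by rewrite big_geq// mulr_ge0// addr_ge0.
apply: (@le_trans _ _ (\sum_(1 <= k < n.+2) (1 + b^-1) * powR (k%:R : R) (- (1 + b)))).
  by apply: ler_sum_nat => k /andP[k0 _]; exact: rb.
rewrite -mulr_sumr ler_wpM2l ?addr_ge0//; apply: le_trans (tel n) _.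
by rewrite lerD2l ler_piMr// gerBl powR_ge0.
Qed.

End Rates.

(** * The MMSE denoiser as a posterior mean, and the proximal map *)

Section Denoiser.
Variable R : realType.
Variable d : nat.
Local Notation vec := 'rV[R]_d.
Implicit Types (u v w x y z : vec).
Variable p : vec -> R.
Hypothesis p0 : forall x, 0 < p x.
Local Notation l := (fun x => ln (p x)).
Hypothesis dl : thrice_differentiable l.
Hypothesis cl : convex_fun (fun z => - ln (p z)).
Variable M : R.
Hypothesis lM : forall x, third_deriv_frob l x <= M.

Lemma MMSE_pmean s z : 0 < s -> MMSE p (Num.sqrt s) z = pmean l s z.
Proof.
move=> s0; set c : R := (Num.sqrt (2 * pi * Num.sqrt s ^+ 2))^-1 ^+ d.
have c0 : 0 < c.
  rewrite exprn_gt0// invr_gt0 sqrtr_gt0 sqr_sqrtr ?ltW// mulr_gt0// mulr_gt0//.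
  exact: pi_gt0.
have e x : p x * gauss (Num.sqrt s) (z - x) = c * pweight l s z x.
  rewrite /gauss -/c mulrCA; congr (_ * _).
  rewrite /pweight expRD lnK ?posrE//; congr (_ * expR _).
  by rewrite enorm_sqr sqr_sqrtr ?ltW// mulNr mulrC.
have vw : gdominated (pweight l s z) by exact: gdominated_pweight.
apply/rowP => j; rewrite !mxE /p_sigma /pexp.
have -> : (fun x => p x * gauss (Num.sqrt s) (z - x)) = (fun x => c * pweight l s z x) by apply/funext.
have -> : (fun x => x 0 j * p x * gauss (Num.sqrt s) (z - x)) = (fun x => c * (x 0 j * pweight l s z x)).
  by apply/funext => x; rewrite -mulrA e mulrCA.
have vx : gdominated (fun x => x 0 j * pweight l s z x) by apply: gdominated_mul => //; exact: subgauss_coord.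
have vcst h : gdominated h -> gdominated (fun x => c * h x) by move=> ?; apply: gdominated_mul => //; exact: subgauss_cst.
rewrite !intRd_intV ?intVZ//; try exact: vcst.
by rewrite -mulf_div divff ?mul1r// gt_eqF.
Qed.

Let dl1 x : differentiable l x. Proof. by case: dl. Qed.

(** Concavity bounds [l] by its tangent at [u], so the sublevel set of [u] lies in the ball of
    radius [2 tau |grad l u|]; a minimiser exists and [xget] returns one. *)
Lemma prox_neglog_min tau u : 0 < tau -> forall z,
  enorm (u - prox_neglog p tau u) ^+ 2 / 2 - tau * ln (p (prox_neglog p tau u))
    <= enorm (u - z) ^+ 2 / 2 - tau * ln (p z).
Proof.
move=> t0; pose g x := enorm (u - x) ^+ 2 / 2 - tau * ln (p x).
have [x xP] : exists x, forall z, g x <= g z.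
  apply: (@exists_min_coercive _ _ g u (2 * tau * enorm (grad l u))).
    rewrite /g; under eq_fun do rewrite enorm_sqr.
    move=> x; apply: (@continuousB _ _ _ (fun x => dotp (u - x) (u - x) / 2) (fun x => tau * ln (p x)) x); apply: continuousM.
    - by apply: continuous_dotp => {}x; apply: continuousB; [exact: cst_continuous|exact: cvg_id|exact: cst_continuous|exact: cvg_id].
    - exact: cst_continuous.
    - exact: cst_continuous.
    - by apply: differentiable_continuous; exact: dl1.
  move=> x; rewrite /g subrr enorm0 expr0n /= mul0r sub0r enormB => h.
  have h1 := @concave_grad_le _ _ l u x cl (dl1 u).
  have h2 := dotp_le (grad l u) (x - u).
  have [->|n0] := eqVneq (enorm (x - u)) 0; first by rewrite !mulr_ge0 ?enorm_ge0 ?ltW.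
  have e0 : 0 < enorm (x - u) by rewrite lt_neqAle eq_sym n0 enorm_ge0.
  rewrite -(ler_pM2r e0); have := ler_wpM2l (ltW t0) (le_trans h1 (lerD (lexx _) h2)).
  rewrite expr2 in h; lra.
by have := @xgetPex _ 0 [set x | forall z, g x <= g z] (ex_intro _ x xP).
Qed.

(** First-order condition at the minimiser, tested in the direction of its own residual [w], which
    gives [|w|^2 <= 0]. *)
Lemma prox_grad tau u : 0 < tau ->
  prox_neglog p tau u - tau *: grad l (prox_neglog p tau u) = u.
Proof.
move=> t0; have := prox_neglog_min u t0; set x := prox_neglog p tau u => H.
pose w := tau *: grad l x + (u - x).
suff w0 : w = 0.
  by apply/eqP; rewrite eq_sym -subr_eq0 opprB addrCA -/w w0.
apply: dotpp_eq0.
have h w' : dotp (grad l x) w' <= - dotp (u - x) w' / tau.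
  apply: (@dir_deriv_le _ _ _ _ _ _ (dotp w' w' / (2 * tau))); first exact: dl1.
  move=> t _; have := H (x + t *: w'); rewrite opprD addrA !enorm_sqr.
  move: (u - x) => v; rewrite !dotpE (dotpC w' v) => H2.
  have tV : 0 <= tau^-1 by rewrite invr_ge0 ltW.
  have := ler_wpM2l tV H2; rewrite -subr_ge0; set Y := (X in 0 <= X) => Y0.
  rewrite -subr_ge0; set X := (X in 0 <= X).
  suff -> : X = Y by [].
  by rewrite /X /Y; field; rewrite gt_eqF.
have := ler_wpM2l (ltW t0) (h w).
have E : dotp w w = tau * dotp (grad l x) w + dotp (u - x) w.
  by transitivity (dotp (tau *: grad l x + (u - x)) w) => //; rewrite [LHS]dotpDl dotpZl.
by rewrite mulrCA mulfV ?gt_eqF// mulr1 E; lra.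
Qed.

(** * Inner and outer iterations *)

Section Inner.
Variable tau : R.
Hypothesis t0 : 0 < tau.

Let s_ (i : nat) : R := tau / i.+1%:R.
Let s_gt0 i : 0 < s_ i. Proof. by rewrite divr_gt0. Qed.

Lemma inner_iterS z0 i : inner_iter p tau z0 i.+1 =
  (i.+1%:R / i.+2%:R) *: pmean l (s_ i) (inner_iter p tau z0 i) + i.+2%:R^-1 *: z0.
Proof.
rewrite /= MMSE_pmean ?s_gt0//; congr (_ + _ *: _).
have -> : i.+1%:R = i.+2%:R - 1 :> R by rewrite -[i.+2]addn1 natrD addrK.
by field; rewrite gt_eqF.
Qed.

Lemma inner_iter_nonexpansive z0 w0 i :
  enorm (inner_iter p tau z0 i - inner_iter p tau w0 i) <= enorm (z0 - w0).
Proof.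
elim: i => [//|i IH]; rewrite !inner_iterS.
set a := i.+1%:R / i.+2%:R; set b := i.+2%:R^-1.
have b0 : 0 <= b by rewrite invr_ge0.
have a0 : 0 <= a by rewrite divr_ge0.
have ab : a + b = 1.
  rewrite /a /b; have -> : i.+1%:R = i.+2%:R - 1 :> R by rewrite -[i.+2]addn1 natrD addrK.
  by field; rewrite gt_eqF.
rewrite opprD addrACA -!scalerBr; apply: le_trans (enorm_triangle _ _) _.
rewrite !enormZ !ger0_norm//.
have h := le_trans (pmean_nonexpansive dl cl _ _ (s_gt0 i)) IH.
by rewrite -[leRHS]mul1r -ab mulrDl lerD2r; exact: ler_wpM2l.
Qed.

(** The initial error is [tau |grad l x|]. Step [n] adds [(n+1) s_n^2 B = tau^2 B / (n+1)] to the
    error weighted by its index, which produces the harmonic sum. *)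
Lemma inner_iter_err x (B : R) n : 0 <= B ->
  (forall s, 0 < s <= tau -> enorm (pmean l s x - x - s *: grad l x) <= s ^+ 2 * B) ->
  enorm (inner_iter p tau (x - tau *: grad l x) n - x) <=
    (tau * enorm (grad l x) + tau ^+ 2 * B * harm R n) / n.+1%:R.
Proof.
move=> B0 HB; rewrite ler_pdivlMr//; set z0 := x - tau *: grad l x.
elim: n => [|n IH].
  rewrite /harm big_ord0 mulr0 addr0 mulr1 /= /z0 addrAC subrr add0r enormN enormZ.
  by rewrite gtr0_norm.
rewrite inner_iterS /harm big_ord_recr /= -/(harm R n) [X in _ <= _ + X]mulrDr addrA.
set z := inner_iter p tau z0 n in IH *; set g := grad l x.
have E2 : n.+2%:R = n.+1%:R + 1 :> R by rewrite -[n.+2]addn1 natrD.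
have n1 : 0 < (n.+1%:R : R) by rewrite ltr0n.
have n2 : 0 < (n.+2%:R : R) by rewrite ltr0n.
(* Since [(n+1) s_n = tau], the displacement [- tau g] of the anchor [z0] supplies exactly the term
   [- s_n g] that compensates the first-order bias of the denoiser. *)
have -> : (n.+1%:R / n.+2%:R) *: pmean l (s_ n) z + n.+2%:R^-1 *: z0 - x =
  (n.+1%:R / n.+2%:R) *: ((pmean l (s_ n) z - pmean l (s_ n) x)
     + (pmean l (s_ n) x - x - s_ n *: g)).
  apply/rowP => j; rewrite /z0 !mxE /s_ -/g.
  move: (pexp l _ z _) (pexp l _ x _) => e1 e2; rewrite E2; field.
  have n0 : 0 <= (n%:R : R) by [].
  by apply/andP; split; apply: lt0r_neq0; lra.
rewrite enormZ ger0_norm ?divr_ge0// mulrAC divfK ?gt_eqF//.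
have h1 := enorm_triangle (pmean l (s_ n) z - pmean l (s_ n) x) (pmean l (s_ n) x - x - s_ n *: g).
have h2 := pmean_nonexpansive dl cl z x (s_gt0 n).
have st : s_ n <= tau by rewrite ler_pdivrMr// ler_peMr ?ler1n// ltW.
have := HB (s_ n); rewrite s_gt0 st => /(_ isT) h3.
have h4 := ler_wpM2l (ltW n1) (le_trans h1 (lerD h2 h3)).
apply: le_trans h4 _; rewrite mulrDr; apply: lerD; first by rewrite mulrC.
by rewrite /s_ le_eqVlt; apply/orP; left; apply/eqP; field; rewrite gt_eqF.
Qed.

End Inner.

End Denoiser.

(** * The outer proximal gradient iteration *)

Section Outer.
Variable R : realType.
Variable d : nat.
Local Notation vec := 'rV[R]_d.
Implicit Types (u v w x y z : vec).

(** The Lipschitz constant is weakened to [1 / a], which is positive whatever the sign of [Lf].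
    Cocoercivity gives [a |g|^2 <= <g,u>] for the differences [g] of gradients and [u] of points, so
    [|u - a g|^2 <= |u|^2]. *)
Lemma grad_step_nonexpansive (f : vec -> R) (Lf a : R) x y : 0 < a -> a * Lf <= 1 ->
  convex_fun f -> L_smooth Lf f ->
  enorm ((x - a *: grad f x) - (y - a *: grad f y)) <= enorm (x - y).
Proof.
move=> a0 aL cf [df sf]; have aV : 0 < a^-1 by rewrite invr_gt0.
have La : Lf <= a^-1 by rewrite -(ler_pM2l a0) mulfV ?gt_eqF.
have lo u v := convex_grad_le v cf (df u).
have up u v := @descent _ _ f a^-1 u v df
  (fun x y => le_trans (sf x y) (ler_wpM2r (enorm_ge0 _) La)).
have h := cocoercive aV lo up x y.
apply: enorm_le; first exact: enorm_ge0.
rewrite enorm_sqr.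
have -> : x - a *: grad f x - (y - a *: grad f y) = (x - y) - a *: (grad f x - grad f y).
  by rewrite scalerBr !opprD !opprK addrACA.
move: (x - y) (grad f x - grad f y) h => u g h.
have h1 := ler_wpM2l (ltW a0) h; rewrite mulrA mulfV ?gt_eqF// mul1r in h1.
have h2 := ler_wpM2l (ltW a0) h1; have g0 := mulr_ge0 (ltW a0) (mulr_ge0 (ltW a0) (dotpp_ge0 g)).
rewrite !dotpE (dotpC u g); lra.
Qed.

(** The direction tested is the gradient of [l - lambda f] itself. The identity turns the forward
    step from a minimiser into [x - tau grad l x], the starting point required by
    [inner_iter_err]. *)
Lemma grad_eq_at_min (f l : vec -> R) (lambda : R) x : differentiable f x -> differentiable l x ->
  (forall z, lambda * f x - l x <= lambda * f z - l z) -> lambda *: grad f x = grad l x.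
Proof.
move=> df dl H; pose g := l - lambda \*: f.
have dg : differentiable g x by apply: differentiableB => //; exact: differentiableZ.
have gE : grad g x = grad l x - lambda *: grad f x.
  apply/rowP => i; rewrite !mxE.
  have := is_deriveB (is_derive_partial i dl) (is_deriveZ lambda (is_derive_partial i df)).
  by move=> ?; exact: derive_val.
suff : grad g x = 0 by rewrite gE => /eqP; rewrite subr_eq0 => /eqP.
apply: dotpp_eq0; apply: (@dir_deriv_le _ _ _ _ _ _ 0) => // t _.
rewrite !mulr0 !addr0; have := H (x + t *: grad g x); set z := x + _ => Hz.
by change (l z - lambda * f z <= l x - lambda * f x); lra.
Qed.

(** Three inequalities are added: the tangent bound for [l] at [x], the tangent bound for [f] at
    [u], and the descent inequality for [f] from [u] to [x]. The step size condition bounds the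
    quadratic term by [|x-u|^2 / (2 tau)], and the three-point identity concludes. *)
Lemma prox_grad_descent (f l : vec -> R) (lambda Lf tau : R) u x xs :
  0 < lambda -> 0 < tau -> tau * (lambda * Lf) <= 1 ->
  convex_fun f -> L_smooth Lf f ->
  convex_fun (fun z => - l z) -> (forall z, differentiable l z) ->
  x - tau *: grad l x = u - (tau * lambda) *: grad f u ->
  (lambda * f x - l x) - (lambda * f xs - l xs) <=
  (2 * tau)^-1 * (enorm (u - xs) ^+ 2 - enorm (x - xs) ^+ 2).
Proof.
move=> l0 t0 tL cf [df sf] cl dl E.
have h1 := concave_grad_le xs cl (dl x).
have h2 := convex_grad_le xs cf (df u).
have h3 := @descent _ _ f Lf u x df sf.
have q0 := dotpp_ge0 (x - u).
have h4 := ler_wpM2l (ltW l0) (le_trans h3 (lerD (lexx _) (lexx _))).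
have h5 := ler_wpM2l (ltW l0) h2.
have i0 : 0 < (2 * tau)^-1 by rewrite invr_gt0 mulr_gt0.
have h6 : lambda * (Lf / 2 * dotp (x - u) (x - u)) <= (2 * tau)^-1 * dotp (x - u) (x - u).
  rewrite !mulrA ler_wpM2r// -(ler_pM2l t0) invfM.
  have -> : tau * (2^-1 / tau) = 2^-1 by rewrite mulrCA mulfV ?mulr1// gt_eqF.
  lra.
have tg : tau *: grad l x = x - u + (tau * lambda) *: grad f u.
  have -> : tau *: grad l x = x - (x - tau *: grad l x) by rewrite opprB addrCA subrr addr0.
  by rewrite E opprB addrA addrAC.
have h7 : dotp (grad l x) (xs - x) = tau^-1 * dotp (x - u) (xs - x) + lambda * dotp (grad f u) (xs - x).
  apply: (@mulfI _ tau); first by rewrite gt_eqF.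
  by rewrite -[LHS]dotpZl tg dotpDl dotpZl; field; rewrite gt_eqF.
rewrite !enorm_sqr.
have -> : (2 * tau)^-1 * (dotp (u - xs) (u - xs) - dotp (x - xs) (x - xs)) =
  (2 * tau)^-1 * dotp (x - u) (x - u) + tau^-1 * dotp (x - u) (xs - x).
  by rewrite !dotpE (dotpC u x) (dotpC xs x) (dotpC xs u); field; rewrite gt_eqF.
have h8 : dotp (grad f u) (x - u) = dotp (grad f u) (xs - u) - dotp (grad f u) (xs - x).
  by rewrite !dotpE; ring.
have h9 := congr1 (fun t => lambda * t) h8; rewrite /= mulrBr in h9.
rewrite !mulrDr in h4 h5; lra.
Qed.

Lemma quasi_monotone_bounded (r q : nat -> R) (A S : R) : 0 <= A ->
  (forall k, r k.+1 <= r k + A * q k.+1) -> (forall n, \sum_(1 <= i < n.+1) q i <= S) ->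
  forall k, r k <= r 0%N + A * S.
Proof.
move=> A0 rS qS k; apply: (@le_trans _ _ (r 0%N + A * \sum_(1 <= i < k.+1) q i)).
  elim: k => [|k IH]; first by rewrite big_geq// mulr0 addr0.
  by rewrite big_nat_recr //= mulrDr addrA (le_trans (rS k))// lerD2r.
by rewrite lerD2l ler_wpM2l.
Qed.

(** The differences do not telescope directly, as [q k] measures the exact update and [r k.+1] the
    approximate one; replacing one square by the other costs at most [2 rho e_(k+1)]. *)
Lemma sum_descent_le (D r q e : nat -> R) (a rho : R) : 0 <= a ->
  (forall k, D k.+1 <= a * (r k ^+ 2 - q k ^+ 2)) ->
  (forall k, r k.+1 <= q k + e k.+1) ->
  (forall k, 0 <= r k <= rho) -> (forall k, 0 <= q k <= rho) -> (forall k, 0 <= e k.+1) ->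
  forall k, \sum_(1 <= i < k.+1) D i <= a * (r 0%N ^+ 2 + 2 * rho * \sum_(1 <= i < k.+1) e i).
Proof.
move=> a0 HD Hr r0 q0 e0 k.
(* The induction needs the term [- r k ^+ 2], which is dropped only in the final bound. *)
apply: (@le_trans _ _ (a * (r 0%N ^+ 2 - r k ^+ 2 + 2 * rho * \sum_(1 <= i < k.+1) e i))); last first.
  by rewrite ler_wpM2l// lerD2r gerBl sqr_ge0.
elim: k => [|k IH]; first by rewrite !big_geq// subrr !mulr0 addr0 mulr0.
rewrite !(big_nat_recr k.+1) //=; apply: le_trans (lerD IH (HD k)) _.
rewrite -mulrDr ler_wpM2l// mulrDr.
move: (\sum_(_ <= _ < _) _) => s.
have /andP[r1 r2] := r0 k.+1; have /andP[q1 q2] := q0 k; have e1 := e0 k; have h := Hr k.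
have : r k.+1 ^+ 2 - q k ^+ 2 <= 2 * rho * e k.+1.
  have [qr|rq] := leP (q k) (r k.+1); nra.
lra.
Qed.

End Outer.

Lemma rate_cst_ge0 (R : realType) (t g B G c : R) : 0 < t -> 0 <= g -> 0 <= B -> 0 <= G ->
  0 < c -> 0 <= (t * g + t ^+ 2 * B * G) / c.
Proof.
move=> t0 g0 B0 G0 c0; apply: divr_ge0; last exact: ltW.
by apply: addr_ge0; apply: mulr_ge0 => //; [exact: ltW|apply: mulr_ge0; [exact: sqr_ge0|]].
Qed.

Theorem theorem2 (R : realType) (d : nat) (p f : 'rV[R]_d -> R)
  (Lf lambda tau c eta : R) (y xstar : 'rV[R]_d) :
  prob_density p ->
  log_concave p -> (forall x, 0 < p x) ->
  thrice_differentiable p ->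
  (exists M : R, forall x, third_deriv_frob (fun z => ln (p z)) x <= M) ->
  convex_fun f -> (exists m : R, forall x, m <= f x) -> L_smooth Lf f ->
  0 < lambda ->
  (forall x, Jobj p f lambda xstar <= Jobj p f lambda x) ->
  0 < tau -> tau * (lambda * Lf) <= 1 ->
  0 < c -> 0 < eta ->
  exists C1 C2 : R, 0 < C1 /\ 0 < C2 /\
    forall k : nat, (1 <= k)%N ->
      (k%:R)^-1 * (\sum_(1 <= i < k.+1) Jobj p f lambda (xexact p f lambda tau c eta y i))
        - Jobj p f lambda xstar <= C1 / k%:R
      /\ enorm (xhat p f lambda tau c eta y k - xexact p f lambda tau c eta y k)
         <= C2 * (1 + ln k%:R) / powR k%:R (1 + eta).
Proof.
move=> _ lc p0 dp [M lM] cf _ sf l0 Jmin t0 tL c0 e0.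
have dl := thrice_differentiable_ln p0 dp.
have cl := convex_neg_ln lc.
have dl1 : forall x, differentiable (fun z => ln (p z)) x by case: dl.
set l := fun z => ln (p z) in dl cl dl1 lM.
have [S S0 HS] := sum_rate_le e0.
have [G G0 HG] := n_iter_rate c0 e0.
pose xh := xhat p f lambda tau c eta y.
pose xe := xexact p f lambda tau c eta y.
pose step u : 'rV[R]_d := u - (tau * lambda) *: grad f u.
pose r k := enorm (xh k - xstar).
have r0 k : 0 <= r k by exact: enorm_ge0.
have stepE : step xstar = xstar - tau *: grad l xstar.
  rewrite /step -(@grad_eq_at_min _ _ f l lambda xstar) ?scalerA//; by case: sf.
have err_rate x B k : 0 <= B -> (0 < k)%N ->
    (forall s, 0 < s <= tau -> enorm (pmean l s x - x - s *: grad l x) <= s ^+ 2 * B) ->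
    enorm (inner_iter p tau (x - tau *: grad l x) (n_iter c eta k) - x) <=
    (tau * enorm (grad l x) + tau ^+ 2 * B * G) / c * rate eta k.
  move=> B0 k0 HB; apply: le_trans (inner_iter_err p0 dl cl t0 _ B0 HB) _.
  apply: (HG _ _ k _ _ k0); apply: mulr_ge0; [exact: ltW|exact: enorm_ge0| |exact: B0].
  exact: sqr_ge0.
(* Radius 0: the bias is needed only at [xstar], so this constant is available before any bound on
   the iterates. *)
have [B0 [g0 [B00 _ /(_ xstar)]]] := bias_uniform dl cl lM xstar t0 (lexx 0).
rewrite subrr enorm0 => /(_ (lexx 0)) [_ Hb0].
pose A0 := (tau * enorm (grad l xstar) + tau ^+ 2 * B0 * G) / c.
have A00 : 0 <= A0 by apply: rate_cst_ge0 => //; exact: enorm_ge0.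
have xhS k : xh k.+1 = inner_iter p tau (step (xh k)) (n_iter c eta k.+1) by [].
have r_step k : r k.+1 <= r k + A0 * rate eta k.+1.
  rewrite /r xhS.
  (* Inserts the inner iteration belonging to [xstar]: nonexpansiveness controls the distance to it,
     and its own error has the known rate. *)
  apply: le_trans (enorm_dist_triangle _ (inner_iter p tau (step xstar) (n_iter c eta k.+1)) _) _.
  apply: lerD; last by rewrite stepE; exact: err_rate.
  apply: le_trans (inner_iter_nonexpansive p0 dl cl t0 _ _ _) _.
  by apply: (grad_step_nonexpansive (Lf := Lf)); rewrite -?mulrA//; exact: mulr_gt0.
have [rho r_le] : exists rho, forall k, r k <= rho.
  by eexists; exact: quasi_monotone_bounded A00 r_step HS.
have rho0 : 0 <= rho := le_trans (r0 0%N) (r_le 0%N).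
(* With the iterates bounded, the constants are taken on the ball of radius [rho], which also
   contains the exact updates by [xe_le]. *)
have [B [g [Bge0 gge0 Hb]]] := bias_uniform dl cl lM xstar t0 rho0.
have xeE k : xe k.+1 - tau *: grad l (xe k.+1) = step (xh k) by exact: prox_grad.
have J_step k : Jobj p f lambda (xe k.+1) - Jobj p f lambda xstar <=
    (2 * tau)^-1 * (r k ^+ 2 - enorm (xe k.+1 - xstar) ^+ 2).
  exact: (prox_grad_descent xstar l0 t0 tL cf sf cl dl1 (xeE k)).
have i0 : 0 < (2 * tau)^-1 by rewrite invr_gt0 mulr_gt0.
have xe_le k : enorm (xe k.+1 - xstar) <= rho.
  (* The left side of [J_step] is nonnegative by minimality, so the exact update is no farther from
     [xstar] than [xh k]. *)
  apply: le_trans (r_le k); have := Jmin (xe k.+1); rewrite -subr_ge0 => h1.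
  have := le_trans h1 (J_step k); rewrite pmulr_rge0// subr_ge0.
  by rewrite ler_pXn2r// nnegrE; exact: enorm_ge0.
pose A := (tau * g + tau ^+ 2 * B * G) / c.
have A_ge0 : 0 <= A by exact: rate_cst_ge0.
have err k : enorm (xh k.+1 - xe k.+1) <= A * rate eta k.+1.
  (* By [xeE] the inner loop starts at [xe k.+1 - tau grad l (xe k.+1)], so [err_rate] applies with
     centre [xe k.+1]. *)
  have [h1 h2] := Hb _ (xe_le k); rewrite xhS -xeE.
  apply: le_trans (err_rate _ _ k.+1 Bge0 isT h2) _.
  apply: ler_wpM2r; first exact: rate_ge0.
  apply: ler_wpM2r; first by rewrite invr_ge0 ltW.
  by rewrite lerD2r; apply: ler_wpM2l => //; exact: ltW.
have sumJ := @sum_descent_le _ (fun k => Jobj p f lambda (xe k) - Jobj p f lambda xstar) r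
  (fun k => enorm (xe k.+1 - xstar)) (fun k => A * rate eta k) _ rho (ltW i0) J_step.
have C0 : 0 <= (2 * tau)^-1 * (r 0%N ^+ 2 + 2 * rho * (A * S)).
  apply: mulr_ge0; first exact: ltW.
  by apply: addr_ge0; [exact: sqr_ge0|apply: mulr_ge0; exact: mulr_ge0].
(* Adding 1 makes both nonnegative constants strictly positive. *)
exists ((2 * tau)^-1 * (r 0%N ^+ 2 + 2 * rho * (A * S)) + 1), (A + 1).
split; first exact: ltr_wpDl.
split; first exact: ltr_wpDl.
case=> [//|k] _; have k0 : 0 < (k.+1%:R : R) by [].
split; last first.
  apply: le_trans (err k) _; rewrite /rate mulrA ler_wpM2r ?invr_ge0 ?powR_ge0//.
  by rewrite ler_wpM2r ?lerDl// addr_ge0// ln_nat_ge0.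
rewrite ler_pdivlMr// mulrBl mulrAC mulVf ?gt_eqF// mul1r.
have : \sum_(1 <= i < k.+2) (Jobj p f lambda (xe i) - Jobj p f lambda xstar) <=
    (2 * tau)^-1 * (r 0%N ^+ 2 + 2 * rho * (A * \sum_(1 <= i < k.+2) rate eta i)).
  rewrite mulr_sumr; apply: sumJ.
  - move=> j; rewrite addrC; apply: le_trans (enorm_dist_triangle _ (xe j.+1) _) _.
    by rewrite lerD2r.
  - by move=> j; rewrite r0 r_le.
  - by move=> j; rewrite enorm_ge0 xe_le.
  - by move=> j; apply: mulr_ge0 => //; exact: rate_ge0.
rewrite sumrB big_const_nat iter_addr_0 subSS subn0 -[_ *+ _]mulr_natr => /le_trans; apply.
apply: ler_wpDr => //; rewrite ler_pM2l// lerD2l.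
by apply: ler_wpM2l; [rewrite mulr_ge0|rewrite ler_wpM2l].
Qed.
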